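(* Let $L^1=L^1(\Omega,\mathcal F,P;\mathbb R)$ and let $\rho:L^1\to\overline{\mathbb R}$ be convex, nondecreasing, with $\rho(0)=0$ and $\rho(\xi+\alpha)=\rho(\xi)+\alpha$ for all $\xi\in L^1$ and $\alpha\in\mathbb R$. Assume that $\rho$ is lower semicontinuous in $L^1$ and that there is a constant $c>0$ such that $\rho(|u|)\le1$ implies $\|u\|_{L^1}\le c$. Endowed with the norm \[ \|u\|_\rho:=\inf\{\beta>0\mid\rho(|u|/\beta)\le1\}, \] $L^\rho:=\{u\in L^1\mid\|u\|_\rho<\infty\}$ is a Banach space whose dual can be identified with $\mathcal M\oplus(L^\infty)^\perp$, where $(L^\infty)^\perp$ is the annihilator of $L^\infty$ in $(L^\rho)^*$ and \[ \mathcal M=\{m\in\mathcal M^1\mid\exists\beta>0:\ \alpha(|m|/\beta)<\infty\},\qquad \alpha(m):=\sup_{\xi\in L^\infty_+}\Big\{\int_\Omega\xi\,dm-\rho(\xi)\Big\}\quad(m\in\mathcal M^1). \] For any $m\in\mathcal M$, the dual norm can be expressed as \[ \|m\|_\rho^*=\sup_{u\in L^\infty}\Big\{\int_\Omega u\,dm\ \Big|\ \rho(|u|)\le1\Big\}=\inf_{\beta>0}\{\beta\alpha(|m|/\beta)+\beta\}, \] and \[ \|m\|_\alpha\le\|m\|_\rho^*\le2\|m\|_\alpha,\qquad\text{where }\|m\|_\alpha:=\inf\{\beta>0\mid\alpha(|m|/\beta)\le1\}. \] Let $\tilde L^\rho$ be the closure of $L^\infty$ in $L^\rho$. 1. If $\rho(\xi^\nu)\searrow0$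 for any decreasing sequence $(\xi^\nu)\subset L^\infty$ with $\xi^\nu\searrow0$ almost surely, then the dual of $\tilde L^\rho$ can be identified with \[ L^\alpha:=\{y\in L^1\mid\exists\beta>0:\ \alpha(|y|/\beta)<\infty\}. \] 2. If $\rho(\xi^\nu)\searrow0$ for any decreasing sequence $(\xi^\nu)\subset\operatorname{dom}\rho$ with $\xi^\nu\searrow0$ almost surely, then \[ \tilde L^\rho=\{u\in L^1\mid\rho(|u|/\beta)<\infty\ \ \forall\beta>0\}, \] and, in particular, $L^\rho=\tilde L^\rho$ if $\operatorname{dom}\rho$ is a cone.
   Context: $(\Omega,\mathcal F,P)$ is a probability space; all random variables here are real-valued. $\operatorname{dom}\rho=\{\xi\in L^1\mid\rho(\xi)<\infty\}$. $\mathcal M^1$ is the set of bounded, $P$-absolutely continuous (vanishing on $P$-null sets), finitely additive real-valued measures on $(\Omega,\mathcal F)$, and $|m|=m^++m^-$ is the variation of $m$. For $u\in L^\infty$, $\int_\Omega u\,dm$ is the norm-continuous linear extension of the integral of simple functions. For $u\in L^1$ let $\rho_m(u):=\sup\{\int_\Omega u'\,dm\mid u'\in L^\infty,\ |u'|\le|u|\}$; $\rho_m$ is a seminorm on $\operatorname{dom}\rho_m=\{u\in L^1\mid\rho_m(u)<\infty\}$, $L^\infty$ is $\rho_m$-dense there, and $\int_\Omega u\,dm$ for $u\in\operatorname{dom}\rho_m$ is the unique $\rho_m$-continuous linear extension of the integral from $L^\infty$. Elements $y\in L^1$ are identified with the countably additive measures $y\,P\in\mathcal M^1$, so $\alpha(y)=\sup_{\xi\in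 L^\infty_+}\{E[\xi y]-\rho(\xi)\}$. The identification of $(L^\rho)^*$ with $\mathcal M\oplus(L^\infty)^\perp$ means that every $u^*\in(L^\rho)^*$ has a unique representation $\langle u,u^*\rangle=\int_\Omega u\,dm+\langle u,w\rangle$ with $m\in\mathcal M$, $w\in(L^\infty)^\perp$ (every $u\in L^\rho$ being in $\operatorname{dom}\rho_m$ for $m\in\mathcal M$), and every such expression is in $(L^\rho)^*$. The identification of $(\tilde L^\rho)^*$ with $L^\alpha$ is via $u\mapsto E[uy]$. *)

(* Defs.v *)
From HB Require Import structures.
From mathcomp Require Import all_boot all_order all_algebra.
From mathcomp Require Import all_classical all_reals all_analysis.

Set Implicit Arguments.
Unset Strict Implicit.
Unset Printing Implicit Defensive.

Import Order.TTheory GRing.Theory Num.Theory.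
Import numFieldNormedType.Exports HBSimple.
Local Open Scope classical_set_scope.
Local Open Scope ring_scope.
Local Open Scope ereal_scope.

(* A normed space is given by a linear subspace V of an ambient module X and
   a [0, +oo]-valued seminorm N.  For function spaces, X consists of
   representatives T -> R, and the points of the space are classes modulo
   a.s. equality, i.e. modulo the kernel of N. *)
Section seminormed_spaces.
Context {R : realType} {X : lmodType R}.
Implicit Types (V D : set X) (N : X -> \bar R) (f : X -> R).

Definition linear_on V f :=
  forall (a : R) u v, V u -> V v -> f (a *: u + v)%R = (a * f u + f v)%R.

Definition continuous_on V N f :=
  forall u, V u -> forall e : R, (0 < e)%R ->
  exists2 r : R, (0 < r)%R &
    forall v, V v -> N (v - u)%R < r%:E -> (`|f v - f u| < e)%R.

(* The topological dual of (V, N).  Two elements are the same functional when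
   they agree on V. *)
Definition dual_space V N : set (X -> R) :=
  [set f | linear_on V f /\ continuous_on V N f].

Definition dual_norm V N f : \bar R :=
  ereal_sup [set `|f u|%:E | u in [set u | V u /\ N u <= 1]].

(* The N-continuous linear extension to V of the map f defined on D; when D is
   N-dense in V its values on V are unique.  Values off V are irrelevant. *)
Definition cont_linear_ext D V N f : X -> R :=
  xget (fun=> 0%R) [set g | [/\ forall u, D u -> g u = f u,
                                linear_on V g & continuous_on V N g]].

Definition closure_in V N D : set X :=
  [set u | V u /\ forall e : R, (0 < e)%R -> exists2 v, D v & N (u - v)%R < e%:E].

Definition complete_on V N :=
  forall u_ : nat -> X, (forall n, V (u_ n)) ->
    (forall e : R, (0 < e)%R -> exists n0 : nat, forall n k : nat,
       (n0 <= n)%N -> (n0 <= k)%N -> N (u_ n - u_ k)%R < e%:E) ->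
  exists2 u, V u & N (u_ n - u)%R @[n --> \oo] --> 0.

End seminormed_spaces.

Section function_spaces.
Context {d : measure_display} {T : measurableType d} {R : realType}.
Variable P : probability T R.
Implicit Types (u v xi y : T -> R) (rho : (T -> R) -> \bar R).

Definition L1 : set (T -> R) := [set u | u \in Lfun P 1].
Definition Linf : set (T -> R) := [set u | u \in Lfun P +oo].
Definition Linf_nneg : set (T -> R) :=
  [set u | Linf u /\ (\forall w \ae P, (0 <= u w)%R)].

(* (V, N), taken modulo a.s. equality, is a Banach space *)
Definition banach_mod_ae (V : set (T -> R)) (N : (T -> R) -> \bar R) :=
  [/\ [/\ V (fun=> 0%R),
          forall (a : R) u v, V u -> V v -> V (a *: u + v)%R &
          forall u v, V u -> measurable_fun setT v ->
            (\forall w \ae P, u w = v w) -> V v],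
      forall u, V u -> 0 <= N u < +oo /\
        (N u = 0 <-> (\forall w \ae P, u w = 0%R)),
      forall (a : R) u, V u -> N (a *: u)%R = `|a|%:E * N u,
      forall u v, V u -> V v -> N (u + v)%R <= N u + N v &
      complete_on V N].

(* Monotonicity is with respect to the a.s. order.  In particular, rho is
   well defined on a.s.-equivalence classes. *)
Definition nondecreasing_L1 rho := forall u v, L1 u -> L1 v ->
  (\forall w \ae P, (u w <= v w)%R) -> rho u <= rho v.

(* Convexity of the epigraph, which avoids the undefined sum +oo - oo *)
Definition convex_L1 rho := forall u v (a b t : R), L1 u -> L1 v ->
  rho u <= a%:E -> rho v <= b%:E -> (0 < t < 1)%R ->
  rho (t *: u + (1 - t) *: v)%R <= (t * a + (1 - t) * b)%:E.

Definition lsc_L1 rho := forall u, L1 u -> forall a : R, a%:E < rho u ->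
  exists2 r : R, (0 < r)%R &
    forall v, L1 v -> 'N[P]_1[EFin \o (v - u)%R] < r%:E -> a%:E < rho v.

Definition dom rho : set (T -> R) := [set u | L1 u /\ rho u < +oo].

Definition is_cone (A : set (T -> R)) :=
  forall (a : R) u, (0 < a)%R -> A u -> A (a *: u)%R.

(* rho(xi_n) decreases to 0 along sequences in A decreasing to 0 a.s.; that
   rho(xi_n) is decreasing follows from monotonicity. *)
Definition vanishes_along_decreasing (A : set (T -> R)) rho :=
  forall xi_ : nat -> T -> R, (forall n, A (xi_ n)) ->
    (forall n, \forall w \ae P, (xi_ n.+1 w <= xi_ n w)%R) ->
    (\forall w \ae P, xi_ n w @[n --> \oo] --> (0 : R)%R) ->
  rho (xi_ n) @[n --> \oo] --> 0.

Definition abs_div u (b : R) : T -> R := fun w => (`|u w| / b)%R.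

Definition norm_rho rho u : \bar R :=
  ereal_inf [set b%:E | b in [set b : R | (0 < b)%R /\ rho (abs_div u b) <= 1]].

Definition Lrho rho : set (T -> R) := [set u | L1 u /\ norm_rho rho u < +oo].

Definition Lrho_tilde rho : set (T -> R) :=
  closure_in (Lrho rho) (norm_rho rho) Linf.

Definition annihilator_Linf rho : set ((T -> R) -> R) :=
  [set z | dual_space (Lrho rho) (norm_rho rho) z /\ forall u, Linf u -> z u = 0%R].

(* Bounded P-absolutely continuous finitely additive real-valued measures.
   Only values on measurable sets matter. *)
Definition M1 : set ({additive_charge set T -> \bar R})%R :=
  [set m | m `<< P /\
    exists K : R, forall A, measurable A -> `|m A| <= K%:E].

(* Jordan decomposition; the library's charge_variation relies on a Hahn
   decomposition, which need not exist for finitely additive measures. *)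
Definition pos_variation (m : set T -> \bar R) (A : set T) : \bar R :=
  ereal_sup [set m B | B in [set B | measurable B /\ B `<=` A]].
Definition neg_variation (m : set T -> \bar R) (A : set T) : \bar R :=
  ereal_sup [set - m B | B in [set B | measurable B /\ B `<=` A]].
Definition variation (m : set T -> \bar R) : set T -> \bar R :=
  pos_variation m \+ neg_variation m.

Definition variation_div (m : set T -> \bar R) (b : R) : set T -> \bar R :=
  fun A => (b^-1)%:E * variation m A.

Definition simple : set (T -> R) :=
  [set u : T -> R | exists s : {sfun T >-> R}, u = s :> (T -> R)].

(* For m in M1, the norm-continuous extension to L^oo of the integral of
   simple functions *)
Definition int_Linf (m : set T -> \bar R) : (T -> R) -> R :=
  cont_linear_ext simple Linf (fun u => 'N[P]_+oo[EFin \o u])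
    (fun u => fine (sintegral m u)).

Definition rho_m (m : set T -> \bar R) u : \bar R :=
  ereal_sup [set (int_Linf m v)%:E |
    v in [set v | Linf v /\ (\forall w \ae P, (`|v w| <= `|u w|)%R)]].

(* The rho_m-continuous extension of int_Linf to dom rho_m *)
Definition int_dom (m : set T -> \bar R) : (T -> R) -> R :=
  cont_linear_ext Linf (dom (rho_m m)) (rho_m m) (int_Linf m).

Definition alpha rho (m : set T -> \bar R) : \bar R :=
  ereal_sup [set (int_Linf m xi)%:E - rho xi | xi in Linf_nneg].

(* alpha at the measure with density y in L^1 *)
Definition alpha_L1 rho y : \bar R :=
  ereal_sup [set 'E_P[xi \* y] - rho xi | xi in Linf_nneg].

Definition Mrho rho : set ({additive_charge set T -> \bar R})%R :=
  [set m | M1 m /\ exists2 b : R, (0 < b)%R & alpha rho (variation_div m b) < +oo].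

Definition Lalpha rho : set (T -> R) :=
  [set y | L1 y /\ exists2 b : R, (0 < b)%R & alpha_L1 rho (abs_div y b) < +oo].

Definition norm_alpha rho (m : set T -> \bar R) : \bar R :=
  ereal_inf [set b%:E |
    b in [set b : R | (0 < b)%R /\ alpha rho (variation_div m b) <= 1]].

(* Norm of u |-> \int u dm as an element of the dual of L^rho *)
Definition dual_norm_rho rho (m : set T -> \bar R) : \bar R :=
  dual_norm (Lrho rho) (norm_rho rho) (int_dom m).

End function_spaces.

(* Main.v *)
Require Import Defs.
From HB Require Import structures.
From mathcomp Require Import all_boot all_order all_algebra.
From mathcomp Require Import all_classical all_reals all_analysis.
From mathcomp Require Import measurable_realfun ess_sup_inf lra ring.

(* A functional F on L^oo that is bounded for the uniform norm is the same thing
   as a finitely additive measure m << P, via m A = F 1_A.  By the Riesz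
   decomposition property, u |-> sup {F v : |v| <= |u|} is additive on the
   positive cone; it equals \int |u| d|m|, so that alpha(|m|/b) becomes a
   conjugate of rho along this positive functional.

   Lower semicontinuity makes {rho(|u|) <= 1} the closed unit ball of L^rho, and
   with the bound ||u||_1 <= c ||u||_rho completeness follows from that of L^1.
   A functional on L^rho restricts to L^oo, where it is given by some m in M;
   since alpha(|m|/b) < oo bounds rho_m by a multiple of ||.||_rho, the integral
   against m extends to L^rho, and what remains annihilates L^oo.  The formula
   for the dual norm is Lagrangian duality for the constraint rho <= 1, with
   Slater point 0.

   When rho vanishes along decreasing sequences of L^oo, 1_A_n -> 0 in L^rho as
   A_n decreases to the empty set, so m is countably additive and Radon-Nikodym
   gives a density; when it vanishes along decreasing sequences of dom rho,
   truncations converge in norm as soon as all the rho(|u|/b) are finite. *)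

Import Order.TTheory GRing.Theory Num.Theory.
Import numFieldNormedType.Exports HBSimple.
Local Open Scope classical_set_scope.
Local Open Scope ring_scope.
Local Open Scope ereal_scope.
Set Implicit Arguments.
Unset Strict Implicit.
Unset Printing Implicit Defensive.

(** * Seminormed spaces *)

Section seminormed_spaces.
Context {R : realType} {X : lmodType R}.
Implicit Types (V D : set X) (N : X -> \bar R) (f g : X -> R).

(** A finitely additive measure need not have a Hahn decomposition, so [|m|] cannot be cut out of
    [m] by a set. Functions are split instead: [clip f u] truncates [f] to [[-|u|, |u|]], and the
    rest of [f] has absolute value exactly [|f| - |clip f u|]. This makes [rho_m] additive on the
    positive cone, and additivity makes [L^oo] dense in [dom rho_m] for [rho_m]: if [v] nearly
    attains [rho_m u], clipping [u] by [v] leaves a remainder of small [rho_m]. Hence the integral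
    against [m] is determined on all of [L^rho] by its values on [L^oo], although [L^oo] need not be
    norm dense there and its annihilator may be nontrivial. Membership in [M] comes from
    [||u|| <= max 1 (rho |u|)], a consequence of convexity and [rho 0 = 0]: a functional bounded on
    [L^oo] by [K] times the norm of [L^rho] is at most [K (1 + rho xi)] at [xi >= 0], so
    [alpha(|m|/K) <= 1]. Conversely, [alpha(|m|/b) <= a] gives the bound [b (a + 1)] on the unit
    ball by Young's inequality; [a = 1] is the source of the factor 2. *)

Definition is_subspace V :=
  V 0%R /\ forall (a : R) u v, V u -> V v -> V (a *: u + v)%R.

Record seminormed V N : Prop := Seminormed {
  seminormed_subspace : is_subspace V;
  seminormed_ge0 : forall u, V u -> 0 <= N u;
  seminormed_lty : forall u, V u -> N u < +oo;
  seminormedZ : forall (a : R) u, V u -> N (a *: u)%R = `|a|%:E * N u;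
  seminormedD : forall u v, V u -> V v -> N (u + v)%R <= N u + N v }.

Definition dense_in V N D :=
  forall u, V u -> forall e : R, (0 < e)%R -> exists2 v, D v & N (u - v)%R < e%:E.

Definition bounded_on V N (K : R) f :=
  forall u, V u -> `|f u|%:E <= K%:E * N u.

Section subspace_theory.
Context V (sV : is_subspace V).

Lemma subspace0 : V 0%R. Proof. by case: sV. Qed.

Lemma subspaceZ a u : V u -> V (a *: u)%R.
Proof. by move=> Vu; rewrite -[(a *: u)%R]addr0; apply: sV.2 => //; exact: subspace0. Qed.

Lemma subspaceD u v : V u -> V v -> V (u + v)%R.
Proof. by move=> Vu Vv; rewrite -[u]scale1r; exact: sV.2. Qed.

Lemma subspaceN u : V u -> V (- u)%R.
Proof. by move=> Vu; rewrite -scaleN1r; exact: subspaceZ. Qed.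

Lemma subspaceB u v : V u -> V v -> V (u - v)%R.
Proof. by move=> Vu Vv; apply: subspaceD => //; exact: subspaceN. Qed.

Context f (lf : linear_on V f).

Lemma linear_onD u v : V u -> V v -> f (u + v)%R = (f u + f v)%R.
Proof. by move=> Vu Vv; rewrite -[u in LHS]scale1r lf// mul1r. Qed.

Lemma linear_on0 : f 0%R = 0%R.
Proof.
have := linear_onD subspace0 subspace0; rewrite addr0 => /eqP.
by rewrite -subr_eq0 opprD addNKr oppr_eq0 => /eqP.
Qed.

Lemma linear_onZ a u : V u -> f (a *: u)%R = (a * f u)%R.
Proof.
by move=> Vu; rewrite -[(a *: u)%R]addr0 lf ?linear_on0 ?addr0//; exact: subspace0.
Qed.

Lemma linear_onN u : V u -> f (- u)%R = (- f u)%R.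
Proof. by move=> Vu; rewrite -scaleN1r linear_onZ// mulN1r. Qed.

Lemma linear_onB u v : V u -> V v -> f (u - v)%R = (f u - f v)%R.
Proof.
by move=> Vu Vv; rewrite linear_onD ?linear_onN//; exact: subspaceN.
Qed.

End subspace_theory.

Section seminormed_theory.
Context V N (sVN : seminormed V N).
Let sV := seminormed_subspace sVN.
Let n u := fine (N u).

Lemma seminormedE u : V u -> N u = (n u)%:E.
Proof.
by move=> Vu; rewrite fineK// ge0_fin_numE ?(seminormed_lty sVN)// (seminormed_ge0 sVN).
Qed.

Lemma fine_seminormed_ge0 u : V u -> (0 <= n u)%R.
Proof. by move=> Vu; rewrite fine_ge0// (seminormed_ge0 sVN). Qed.

Lemma fine_seminormedZ a u : V u -> n (a *: u)%R = (`|a| * n u)%R.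
Proof. by move=> Vu; rewrite /n (seminormedZ sVN)// (seminormedE Vu). Qed.

Lemma fine_seminormedD u v : V u -> V v -> (n (u + v)%R <= n u + n v)%R.
Proof.
move=> Vu Vv; rewrite -lee_fin EFinD -!seminormedE//; last exact: subspaceD.
exact: (seminormedD sVN).
Qed.

Lemma seminormed0 : N 0%R = 0.
Proof.
rewrite -(scale0r 0%R) (seminormedZ sVN) ?normr0 ?mul0e//; exact: subspace0.
Qed.

Lemma seminormedN u : V u -> N (- u)%R = N u.
Proof. by move=> Vu; rewrite -scaleN1r (seminormedZ sVN)// normrN1 mul1e. Qed.

Lemma seminormed_sym u v : V u -> V v -> N (u - v)%R = N (v - u)%R.
Proof. by move=> Vu Vv; rewrite -opprB seminormedN//; exact: subspaceB. Qed.

Lemma bounded_continuous f K :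
  linear_on V f -> bounded_on V N K f -> continuous_on V N f.
Proof.
move=> lf bf u Vu e e0; exists (e / (`|K| + 1))%R.
  by rewrite divr_gt0// ltr_wpDl.
move=> v Vv; have Vvu := subspaceB sV Vv Vu.
rewrite -(linear_onB sV lf)// seminormedE// lte_fin => h.
have := bf _ Vvu; rewrite seminormedE// -EFinM lee_fin => /le_lt_trans; apply.
have n0 := fine_seminormed_ge0 Vvu.
rewrite ltr_pdivlMr ?ltr_wpDl// in h; apply: le_lt_trans h.
rewrite mulrC ler_wpM2l// (le_trans (ler_norm _))// lerDl//.
Qed.

Lemma continuous_bounded f : linear_on V f -> continuous_on V N f ->
  exists2 K, (0 < K)%R & bounded_on V N K f.
Proof.
move=> lf cf; have [r r0 hr] := cf _ (subspace0 sV) 1%R ltr01.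
exists (r^-1 * 2)%R; first by rewrite mulr_gt0// invr_gt0.
move=> u Vu; have n0 := fine_seminormed_ge0 Vu.
rewrite seminormedE// -EFinM lee_fin; apply/ler_addgt0Pr => e e0.
(* [t] brings [u] to seminorm at most [r / 2], so [f] is at most 1 in absolute value there and
   [|f u| <= 1 / t = 2 / r * n u + e]. The summand [e * r / 2] keeps the denominator positive when
   [n u = 0]. *)
pose t := (r / (2 * (n u + e * r / 2)))%R.
have q0 : (0 < n u + e * r / 2)%R by rewrite ltr_wpDl// divr_gt0// mulr_gt0.
have t0 : (0 < t)%R by rewrite divr_gt0// mulr_gt0.
have := hr (t *: u)%R (subspaceZ sV _ Vu).
rewrite subr0 (linear_on0 sV lf) subr0 (linear_onZ sV lf)//.
rewrite (seminormedE (subspaceZ sV _ Vu)) fine_seminormedZ// lte_fin gtr0_norm//.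
rewrite normrM gtr0_norm// => /(_ _)/ltW h.
have : (t * `|f u| <= 1)%R.
  apply: h; rewrite /t mulrAC ltr_pdivrMr ?mulr_gt0// ltr_pM2l//.
  have : (0 < e * r)%R by rewrite mulr_gt0.
  lra.
rewrite /t mulrAC ler_pdivrMr ?mulr_gt0// mul1r => k.
rewrite -(ler_pM2l r0) (le_trans k)//.
rewrite [leRHS](_ : _ = 2 * (n u + e * r / 2))%R//.
by field; rewrite gt_eqF.
Qed.

Lemma eq_on_dense D f g : D `<=` V -> dense_in V N D ->
  continuous_on V N f -> continuous_on V N g ->
  (forall u, D u -> f u = g u) -> forall u, V u -> f u = g u.
Proof.
move=> DV dD cf cg fg u Vu; apply/eqP; rewrite -subr_eq0 -normr_le0.
apply/ler_addgt0Pr => e e0; rewrite add0r.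
have e2 : (0 < e / 2)%R by rewrite divr_gt0.
have [r r0 hr] := cf _ Vu _ e2; have [s s0 hs] := cg _ Vu _ e2.
have [|v Dv hv] := dD _ Vu (Num.min r s); first by rewrite lt_min r0.
rewrite seminormed_sym// in hv; last exact: DV.
have := hr _ (DV _ Dv); have := hs _ (DV _ Dv); rewrite fg// => h1 h2.
have {}h1 : (`|g v - g u| < e / 2)%R.
  by apply/h1/(lt_le_trans hv); rewrite lee_fin ge_min lexx orbT.
have {}h2 : (`|g v - f u| < e / 2)%R.
  by apply/h2/(lt_le_trans hv); rewrite lee_fin ge_min lexx.
rewrite (_ : (f u - g u) = (g v - g u) - (g v - f u))%R; last by ring.
by rewrite (le_trans (ler_normB _ _))// [leRHS]splitr lerD// ltW.
Qed.

(** Since [h] meets the defining conditions, [xget] does not return its default; whichever extension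
    it returns agrees with [h] on [D], hence on [V] by density. *)
Lemma cont_linear_ext_unique D f h : D `<=` V -> dense_in V N D ->
  linear_on V h -> continuous_on V N h -> (forall u, D u -> h u = f u) ->
  forall u, V u -> cont_linear_ext D V N f u = h u.
Proof.
move=> DV dD lh ch hf; rewrite /cont_linear_ext.
case: xgetP => [g _ [gf lg cg]|/(_ h)[]//].
by apply: (eq_on_dense DV dD cg ch) => u Du; rewrite gf ?hf.
Qed.

(** The extension is given by the McShane formula [g u = sup_(v in D) (f v - K * n (u - v))], which
    avoids limits of sequences and keeps the constant [K]. Linearity is not visible in the formula
    and comes from density. *)
Lemma cont_linear_extP D f K : (0 <= K)%R -> is_subspace D -> D `<=` V -> dense_in V N D ->
  linear_on D f -> bounded_on D N K f ->
  [/\ forall u, D u -> cont_linear_ext D V N f u = f u,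
      linear_on V (cont_linear_ext D V N f) &
      bounded_on V N K (cont_linear_ext D V N f)].
Proof.
move=> K0 sD DV dD lf bf.
pose A u := [set f v - K * n (u - v) | v in D]%R.
pose g u := sup (A u).
have ub u v : V u -> D v -> ubound (A u) (f v + K * n (u - v))%R.
  move=> Vu Dv _ [w Dw <-].
  have Vuw := subspaceB sV Vu (DV _ Dw); have Vuv := subspaceB sV Vu (DV _ Dv).
  have := bf _ (subspaceB sD Dw Dv).
  rewrite seminormedE; last by apply: (subspaceB sV); exact: DV.
  rewrite lee_fin (linear_onB sD lf)// => /(le_trans (ler_norm _)) h.
  suff : (K * n (w - v) <= K * n (u - w) + K * n (u - v))%R by lra.
  rewrite -mulrDr ler_wpM2l//; have -> : (w - v = (-1) *: (u - w) + (u - v))%R.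
    by rewrite scaleN1r opprB addrA subrK.
  rewrite (le_trans (fine_seminormedD _ _))// ?fine_seminormedZ// ?normrN1 ?mul1r//.
  exact: subspaceZ.
(* All properties of [g] follow from this estimate: [v = u] gives the values on [D], [v = 0] the
   bound [K], and density the linearity. *)
have gP u v : V u -> D v -> (`|g u - f v| <= K * n (u - v))%R.
  move=> Vu Dv; have hs : has_sup (A u).
    by split; [exists (f v - K * n (u - v))%R; exists v|eexists; exact: (ub u v)].
  rewrite ler_norml; apply/andP; split.
    by rewrite lerBrDl; apply: ub_le_sup; [exact: hs.2|exists v].
  rewrite lerBlDl; apply: ge_sup; first exact: hs.1.
  exact: ub.
have gf u : D u -> g u = f u.
  move=> Du; apply/eqP; rewrite -subr_eq0 -normr_le0.
  by rewrite (le_trans (gP _ _ (DV _ Du) Du))// subrr /n seminormed0 mulr0.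
have lg : linear_on V g.
  move=> a u w Vu Vw; apply/eqP; rewrite -subr_eq0 -normr_le0.
  apply/ler_addgt0Pr => e e0; rewrite add0r.
  (* The two sides differ by at most [2 * K * (|a| * n (u - u') + n (w - w'))]. Each [+ 1] keeps a
     factor positive when [K] or [a] is zero. *)
  pose q := (2 * (K + 1) * (`|a| + 1))%R.
  have q0 : (0 < q)%R by rewrite !mulr_gt0// ltr_wpDl.
  have eq0 : (0 < e / q)%R by rewrite divr_gt0.
  have [u' Du' hu] := dD _ Vu _ eq0; have [w' Dw' hw] := dD _ Vw _ eq0.
  have Vu' := DV _ Du'; have Vw' := DV _ Dw'.
  have := gP _ _ (sV.2 a _ _ Vu Vw) (sD.2 a _ _ Du' Dw'); rewrite lf//.
  have -> : (a *: u + w - (a *: u' + w') = a *: (u - u') + (w - w'))%R.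
    by rewrite scalerBr opprD addrACA.
  have Vuu := subspaceB sV Vu Vu'; have Vww := subspaceB sV Vw Vw'.
  have h1 := gP _ _ Vu Du'; have h2 := gP _ _ Vw Dw'.
  rewrite seminormedE// lte_fin in hu; rewrite seminormedE// lte_fin in hw.
  have h3 : (K * n (a *: (u - u') + (w - w')) <= K * (`|a| * n (u - u') + n (w - w')))%R.
    rewrite ler_wpM2l// (le_trans (fine_seminormedD _ _))// ?fine_seminormedZ//.
    exact: subspaceZ.
  move=> /le_trans /(_ h3) h4.
  have h1' : (`|a * (g u - f u')| <= `|a| * (K * n (u - u')))%R by rewrite normrM ler_wpM2l.
  rewrite [X in `|X|%R](_ : _ = g (a *: u + w) - (a * f u' + f w')
    - (a * (g u - f u') + (g w - f w')))%R; last by ring.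
  rewrite (le_trans (ler_normB _ _))//.
  rewrite (le_trans (lerD h4 (le_trans (ler_normD _ _) (lerD h1' h2))))//.
  have nu := fine_seminormed_ge0 Vuu; have nw := fine_seminormed_ge0 Vww.
  have a0 := normr_ge0 a.
  have -> : (e = 2 * (K + 1) * (`|a| * (e / q) + e / q))%R.
    rewrite /q; field; rewrite !gt_eqF//; exact: ltr_wpDl.
  rewrite -/(n _) in hu hw *.
  have hau : (`|a| * n (u - u') <= `|a| * (e / q))%R by rewrite ler_wpM2l// ltW.
  have an0 : (0 <= `|a| * n (u - u'))%R by rewrite mulr_ge0.
  rewrite [leLHS](_ : _ = 2 * (K * (`|a| * n (u - u') + n (w - w'))))%R; last by ring.
  rewrite -mulrA ler_pM2l//; apply: ler_pM => //.
  - exact: addr_ge0.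
  - by rewrite lerDl.
  - by rewrite lerD// ltW.
have bg : bounded_on V N K g.
  move=> u Vu; have := gP _ _ Vu (subspace0 sD).
  by rewrite (linear_on0 sD lf) !subr0 (seminormedE Vu) -EFinM lee_fin.
have e := cont_linear_ext_unique DV dD lg (bounded_continuous lg bg) gf.
split=> [u Du|a u v Vu Vv|u Vu].
- by rewrite e ?gf//; exact: DV.
- by rewrite !e//; [exact: lg|exact: sV.2].
- by rewrite e//; exact: bg.
Qed.

End seminormed_theory.
End seminormed_spaces.

(** * Lebesgue spaces *)

Section lebesgue_spaces.
Context {d : measure_display} {T : measurableType d} {R : realType}.
Variable P : probability T R.
Implicit Types (u v : T -> R).

Lemma Lfun_seminormed (p : \bar R) : 1 <= p ->
  seminormed [set u : T -> R | u \in Lfun P p] (fun u => 'N[P]_p[EFin \o u]).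
Proof.
move=> p1.
have [h0 h1] := @Lfun_submod_closed _ T R P p p1.
have mL u : u \in Lfun P p -> measurable_fun setT u.
  by move=> /sub_Lfun_mfun; rewrite inE.
split => /=.
- by split=> // a u v; exact: h1.
- by move=> u _; exact: Lnorm_ge0.
- by move=> u /sub_Lfun_finLfun; rewrite inE.
- by move=> a u Lu; exact: (@LnormZ _ T R P p p1 (Lfun_Sub p1 Lu) a).
- by move=> u v Lu Lv; apply: (@eminkowski _ _ _ P u v) => //; exact: mL.
Qed.

Lemma L1_seminormed : seminormed (L1 P) (fun u => 'N[P]_1[EFin \o u]).
Proof. exact: Lfun_seminormed. Qed.

Lemma Linf_seminormed : seminormed (Linf P) (fun u => 'N[P]_+oo[EFin \o u]).
Proof. by apply: Lfun_seminormed; rewrite leey. Qed.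

Lemma subspace_L1 : is_subspace (L1 P).
Proof. exact: seminormed_subspace L1_seminormed. Qed.

Lemma subspace_Linf : is_subspace (Linf P).
Proof. exact: seminormed_subspace Linf_seminormed. Qed.

Lemma L1P u : L1 P u <-> measurable_fun setT u /\ 'N[P]_1[EFin \o u] < +oo.
Proof.
split=> [/andP[]|[mu nu]]; first by rewrite !inE.
by apply/andP; rewrite !inE.
Qed.

Lemma L1_measurable u : L1 P u -> measurable_fun setT u.
Proof. by move=> /L1P[]. Qed.

Lemma L1_integrable u : L1 P u <-> P.-integrable setT (EFin \o u).
Proof. exact: Lfun1_integrable. Qed.

Lemma Linf_norm_le u (k : R) :
  'N[P]_+oo[EFin \o u] <= k%:E <-> \forall w \ae P, (`|u w| <= k)%R.
Proof.
(* The norm at infinity is an essential supremum only when the total mass is positive; here it is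
   1. *)
rewrite unlock /= (_ : 0 < P setT = true) ?[X in _ < X]probability_setT ?lte01//.
split => [/ess_supP|h].
  by apply: filterS => w; rewrite lee_fin.
by apply/ess_supP; apply: filterS h => w; rewrite lee_fin.
Qed.

Lemma LinfP u : Linf P u <->
  measurable_fun setT u /\ exists k : R, \forall w \ae P, (`|u w| <= k)%R.
Proof.
split=> [/andP[]|[mu [k hk]]].
  rewrite !inE /= /finite_norm => mu nu; split => //.
  exists (fine 'N[P]_+oo[EFin \o u]); apply/Linf_norm_le.
  by rewrite fineK// ge0_fin_numE// Lnorm_ge0.
apply/andP; rewrite !inE /= /finite_norm; split => //.
by apply: (@le_lt_trans _ _ k%:E); [exact/Linf_norm_le|exact: ltry].
Qed.

Lemma Linf_measurable u : Linf P u -> measurable_fun setT u.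
Proof. by move=> /LinfP[]. Qed.

Lemma Linf_ae_bound u : Linf P u ->
  exists2 k : R, (0 < k)%R & \forall w \ae P, (`|u w| <= k)%R.
Proof.
move=> /LinfP[_ [k hk]]; exists (`|k| + 1)%R; first by rewrite ltr_wpDl.
apply: filterS hk => w /le_trans; apply.
by rewrite (le_trans (ler_norm _))// lerDl.
Qed.

Lemma Linf_L1 u : Linf P u -> L1 P u.
Proof. by apply: Lfun_subset; rewrite ?leey//; exact: fin_num_measure. Qed.

Lemma Linf_ae_dominated u v : measurable_fun setT u -> Linf P v ->
  (\forall w \ae P, (`|u w| <= `|v w|)%R) -> Linf P u.
Proof.
move=> mu /LinfP[_ [k hk]] uv; apply/LinfP; split => //; exists k.
by apply: filterS2 uv hk => w; exact: le_trans.
Qed.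

Lemma Linf_bounded u (k : R) : measurable_fun setT u ->
  (forall w, `|u w| <= k)%R -> Linf P u.
Proof. by move=> mu uk; apply/LinfP; split => //; exists k; exact: nearW. Qed.

Lemma Linf_cst (k : R) : Linf P (fun=> k).
Proof. exact: (@Linf_bounded _ `|k|). Qed.

Lemma Linf_indic A : measurable A -> Linf P (\1_A : T -> R).
Proof.
move=> mA; apply: (@Linf_bounded _ 1) => // w.
by rewrite indicE; case: (_ \in _); rewrite ?normr1 ?normr0.
Qed.

Lemma L1_cst (k : R) : L1 P (fun=> k).
Proof. exact/Linf_L1/Linf_cst. Qed.

Lemma le_Lnorm1 u v : measurable_fun setT u -> measurable_fun setT v ->
  (\forall w \ae P, (`|u w| <= `|v w|)%R) ->
  'N[P]_1[EFin \o u] <= 'N[P]_1[EFin \o v].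
Proof.
move=> mu mv uv; rewrite !Lnorm1; apply: ae_ge0_le_integral => //.
- by apply: measurableT_comp => //; exact/measurable_EFinP.
- by apply: measurableT_comp => //; exact/measurable_EFinP.
- by apply: filterS uv => w h _; rewrite /= lee_fin.
Qed.

Lemma L1_ae_dominated u v : measurable_fun setT u -> L1 P v ->
  (\forall w \ae P, (`|u w| <= `|v w|)%R) -> L1 P u.
Proof.
move=> mu /L1P[mv nv] uv; apply/L1P; split => //.
exact: le_lt_trans (le_Lnorm1 mu mv uv) nv.
Qed.

Lemma L1_norm u : L1 P u -> L1 P (fun w => `|u w|%R).
Proof. exact: Lfun_norm. Qed.

Lemma Linf_norm u : Linf P u -> Linf P (fun w => `|u w|%R).
Proof.
move=> Lu; apply: (Linf_ae_dominated _ Lu).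
  by apply: measurableT_comp => //; exact: Linf_measurable.
by apply: nearW => w; rewrite normr_id.
Qed.

Lemma abs_div_ge0 u (b : R) w : (0 <= b)%R -> (0 <= abs_div u b w)%R.
Proof. by move=> b0; rewrite /abs_div divr_ge0. Qed.

Lemma abs_divE u b : abs_div u b = (b^-1 *: (fun w => `|u w|))%R.
Proof. by apply/funext => w; rewrite /abs_div mulrC. Qed.

Lemma L1_abs_div u b : L1 P u -> L1 P (abs_div u b).
Proof. by move=> Lu; rewrite abs_divE; apply: (subspaceZ subspace_L1); exact: L1_norm. Qed.

Lemma Linf_abs_div u b : Linf P u -> Linf P (abs_div u b).
Proof. by move=> Lu; rewrite abs_divE; apply: (subspaceZ subspace_Linf); exact: Linf_norm. Qed.

Lemma simpleP u : simple u <-> measurable_fun setT u /\ finite_set (range u).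
Proof.
split=> [[s ->]|[mu fu]]; first by split.
have us : u \in @sfun _ T R by rewrite inE; apply/andP; rewrite !inE.
by exists (sfun_Sub us).
Qed.

Lemma finite_set_range2 (f g : T -> R) (h : R -> R -> R) :
  finite_set (range f) -> finite_set (range g) ->
  finite_set (range (fun w => h (f w) (g w))).
Proof.
move=> ff fg; apply: sub_finite_set (finite_image2 h ff fg).
by move=> _ [w _ <-]; exists (f w); [exists w|exists (g w); [exists w|]].
Qed.

Lemma subspace_simple : is_subspace (@simple d T R).
Proof.
split=> [|a u v /simpleP[mu fu] /simpleP[mv fv]]; apply/simpleP; split.
- exact: measurable_cst.
- by apply: sub_finite_set (finite_set1 0%R) => _ [w _ <-].
- by apply: measurable_funD => //; exact: measurable_funM.
- exact: (finite_set_range2 (fun x y => a * x + y)%R).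
Qed.

Lemma simple_indic A : measurable A -> simple (\1_A : T -> R).
Proof.
move=> mA; apply/simpleP; split; first exact: measurable_indic.
apply: (@sub_finite_set _ _ [set 0%R; 1%R]) => // _ [w _ <-].
by rewrite indicE; case: (_ \in _); [right|left].
Qed.

Lemma simple_Linf u : simple u -> Linf P u.
Proof.
move=> /simpleP[mu /finite_seqP[r ru]].
apply: (@Linf_bounded _ (\sum_(x <- r) `|x|)%R) => // w.
have : u w \in r by have : range u (u w) by []; rewrite ru.
elim: r {ru} => //= x r ih; rewrite inE big_cons => /orP[/eqP->|/ih].
  by rewrite lerDl sumr_ge0.
by move=> /le_trans; apply; rewrite lerDr.
Qed.

(* The approximant is [h * floor (u / h)] with [h = e / 2], written as a finite
   sum of indicators so that it is visibly simple. *)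
Lemma dense_simple : dense_in (Linf P) (fun u => 'N[P]_+oo[EFin \o u]) (@simple d T R).
Proof.
move=> u Lu e e0; have [k k0 hk] := Linf_ae_bound Lu.
pose h := (e / 2)%R; have h0 : (0 < h)%R by rewrite divr_gt0.
pose n := Num.truncn (k / h).
pose s := (fun w => \sum_(i < 2 * n.+1 + 1)
   ((i%:R - n.+1%:R) * h) * \1_(u @^-1` `[((i%:R - n.+1%:R) * h), ((i%:R + 1 - n.+1%:R) * h)[) w)%R.
have mB (a b : R) : measurable (u @^-1` `[a, b[).
  by rewrite -[X in measurable X]setTI; apply: (Linf_measurable Lu).
exists s.
  rewrite (_ : s = \sum_(i < 2 * n.+1 + 1) ((i%:R - n.+1%:R) * h) *:
    (\1_(u @^-1` `[((i%:R - n.+1%:R) * h), ((i%:R + 1 - n.+1%:R) * h)[) : T -> R))%R; last first.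
    by apply/funext => w; rewrite /s fct_sumE.
  apply: big_ind.
  - exact: (subspace0 subspace_simple).
  - by move=> ? ?; apply: (subspaceD subspace_simple).
  - move=> i _; apply: (subspaceZ subspace_simple); exact: simple_indic.
apply: (@le_lt_trans _ _ h%:E); last first.
  by rewrite lte_fin /h ltr_pdivrMr// ltr_pMr// ltr1n.
apply/Linf_norm_le; apply: filterS hk => w hw.
have [i iu] : exists i : 'I_(2 * n.+1 + 1),
    ((i%:R - n.+1%:R) * h <= u w < (i%:R + 1 - n.+1%:R) * h)%R.
  have kn : (k < n.+1%:R * h)%R.
    by rewrite -ltr_pdivrMr// truncnS_gt.
  (* [Num.truncn] is a floor only at nonnegative arguments, hence the shift by [n.+1]. *)
  have y0 : (0 <= u w / h + n.+1%:R)%R.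
    rewrite -lerBlDr sub0r ler_pdivlMr// mulNr.
    by move: hw; rewrite ler_norml => /andP[? _]; lra.
  have := truncn_itv y0; set j := Num.truncn _ => /andP[j1 j2].
  have jn : (j < 2 * n.+1 + 1)%N.
    rewrite -(ltr_nat R) (le_lt_trans j1)// natrD natrM.
    suff : (u w / h <= n.+1%:R)%R by lra.
    rewrite ler_pdivrMr//; move: hw; rewrite ler_norml => /andP[_ ?]; lra.
  exists (Ordinal jn) => /=; rewrite -ler_pdivlMr// -ltr_pdivrMr//.
  by move: j1 j2; rewrite -addn1 natrD => j1 j2; apply/andP; split; lra.
have hin (j : 'I_(2 * n.+1 + 1)) :
    ((j%:R - n.+1%:R) * h <= u w < (j%:R + 1 - n.+1%:R) * h)%R -> j = i.
  move=> /andP[j1 j2]; move: iu => /andP[i1 i2].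
  have := le_lt_trans j1 i2; have := le_lt_trans i1 j2.
  rewrite !ltr_pM2r// => ij ji; apply/val_inj/eqP => /=.
  have lt_succ (a b : nat) : (a%:R - n.+1%:R < b%:R + 1 - n.+1%:R :> R)%R -> (a <= b)%N.
    by move=> ab; rewrite -ltnS -(ltr_nat R) -natr1; lra.
  by rewrite eqn_leq; apply/andP; split; exact: lt_succ.
rewrite !fctE /s (bigD1 i)//= big1 ?addr0 => [|j /eqP ji]; last first.
  rewrite indicE memNset ?mulr0//= in_itv/= => jj; exact/ji/hin.
rewrite indicE mem_set /= ?in_itv//= mulr1 ger0_norm; last first.
  by rewrite subr_ge0; case/andP: iu.
by case/andP: iu => _; lra.
Qed.

End lebesgue_spaces.

(** * Finitely additive integration *)

Section finitely_additive.
Context {d : measure_display} {T : measurableType d} {R : realType}.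
Implicit Types (mu : set T -> R) (nu : set T -> \bar R) (s t : T -> R).

Definition fin_additive mu := forall A B, measurable A -> measurable B ->
  A `&` B = set0 -> mu (A `|` B) = (mu A + mu B)%R.

Lemma fin_additive0 mu : fin_additive mu -> mu set0 = 0%R.
Proof.
move=> /(_ set0 set0 measurable0 measurable0); rewrite setI0 setU0 => /(_ erefl)/eqP.
by rewrite -subr_eq0 opprD addNKr oppr_eq0 => /eqP.
Qed.

Section disjoint_family.
Context (K : choiceType) (E : K -> set T) (r : seq K) (ur : uniq r).
Hypothesis mE : forall k, measurable (E k).
Hypothesis dE : forall k l, k != l -> E k `&` E l = set0.
Context mu (amu : fin_additive mu).

Lemma fin_additive_bigsetU (p : pred K) :
  mu (\big[setU/set0]_(k <- r | p k) E k) = (\sum_(k <- r | p k) mu (E k))%R.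
Proof.
elim: r ur => [|k s ih /= /andP[ks us]]; first by rewrite !big_nil fin_additive0.
rewrite !big_cons; case: ifPn => pk; last exact: ih.
rewrite amu ?ih//; first exact: bigsetU_measurable.
rewrite -bigcup_seq_cond; apply/seteqP; split=> // w [Ew [l /= /andP[ls _] Elw]].
have : (E k `&` E l) w by [].
by rewrite dE//; apply: contraNneq ks => ->.
Qed.

(** Substitute for a Hahn decomposition: the cells with [mu (E k) >= 0] are merged into one set and
    the others into a second one, so that the sum of the [|mu (E k)|] involves only two values of
    [mu]. The alternative [mu (E k) = 0] admits cells on which a bound valid almost everywhere
    fails. *)
Lemma fin_additive_le_variation (x : K -> R) A (M a b : R) :
  (forall k, E k `<=` A) -> (0 <= M)%R ->
  (forall k, (`|x k| <= M)%R \/ mu (E k) = 0%R) ->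
  (forall B, measurable B -> B `<=` A -> (mu B <= a)%R) ->
  (forall B, measurable B -> B `<=` A -> (- mu B <= b)%R) ->
  (\sum_(k <- r) x k * mu (E k) <= M * (a + b))%R.
Proof.
move=> EA M0 xM ha hb.
apply: (@le_trans _ _ (\sum_(k <- r) M * `|mu (E k)|)%R).
  apply: ler_sum => k _; rewrite (le_trans (ler_norm _))// normrM.
  by case: (xM k) => [xk|->]; rewrite ?normr0 ?mulr0// ler_wpM2r.
rewrite -mulr_sumr ler_wpM2l// (bigID (fun k => 0 <= mu (E k))%R)/=.
have subA (p : pred K) : \big[setU/set0]_(k <- r | p k) E k `<=` A.
  by rewrite -bigcup_seq_cond => w [k _ /EA].
have mA (p : pred K) : measurable (\big[setU/set0]_(k <- r | p k) E k).
  exact: bigsetU_measurable.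
rewrite lerD//.
- rewrite (eq_bigr (fun k => mu (E k))) => [|k /ger0_norm//].
  by rewrite -fin_additive_bigsetU; apply: ha.
- rewrite (eq_bigr (fun k => - mu (E k)))%R => [|k]; last first.
    by rewrite -ltNge => /ltr0_norm.
  by rewrite sumrN -fin_additive_bigsetU; apply: hb.
Qed.

End disjoint_family.

Lemma preimage_set1_disjoint (K : choiceType) (f : T -> K) (k l : K) :
  k != l -> f @^-1` [set k] `&` f @^-1` [set l] = set0.
Proof.
by move=> /eqP kl; apply/seteqP; split=> // w [/= fk fl]; apply: kl; rewrite -fk.
Qed.

(** Each level set of [phi \o f] is a disjoint union of fibers of [f]. With [f] the pair of two
    simple functions, a sum over the values of either one, or of a combination, becomes a sum over
    their common refinement. *)
Lemma sum_fiber mu (K : choiceType) (f : T -> K) (r : seq K) (phi : K -> R) :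
  fin_additive mu -> (forall k, measurable (f @^-1` [set k])) ->
  uniq r -> (forall w, f w \in r) ->
  (\sum_(x <- undup (map phi r)) x * mu ((phi \o f) @^-1` [set x]) =
   \sum_(k <- r) phi k * mu (f @^-1` [set k]))%R.
Proof.
move=> amu mf ur fr.
transitivity (\sum_(x <- undup (map phi r)) \sum_(k <- r | phi k == x)
    phi k * mu (f @^-1` [set k]))%R.
  apply: eq_bigr => x _.
  transitivity (x * \sum_(k <- r | phi k == x) mu (f @^-1` [set k]))%R; last first.
    by rewrite mulr_sumr; apply: eq_bigr => k /eqP ->.
  congr (_ * _)%R; rewrite -fin_additive_bigsetU//; last exact: preimage_set1_disjoint.
  congr mu; rewrite -bigcup_seq_cond; apply/seteqP; split=> w /=.
    by move=> <-; exists (f w) => //=; rewrite fr eqxx.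
  by move=> [k /andP[_ /eqP <-] /= ->].
rewrite (exchange_big_dep xpredT)//= big_seq [RHS]big_seq; apply: eq_bigr => k kr.
rewrite (eq_bigl (pred1 (phi k))); last by move=> x /=; rewrite eq_sym.
by rewrite -big_filter filter_pred1_uniq ?undup_uniq ?mem_undup ?map_f// big_seq1.
Qed.

Lemma fine_sintegral_seq nu s (r : seq R) : nu set0 = 0 ->
  (forall x, nu (s @^-1` [set x]) \is a fin_num) -> uniq r -> (forall w, s w \in r) ->
  fine (sintegral nu s) = (\sum_(x <- r) x * fine (nu (s @^-1` [set x])))%R.
Proof.
move=> nu0 nus ur sr; rewrite /sintegral -(fsbig_widen [set` r])//=; last first.
  move=> x [_ /= xr]; rewrite (_ : s @^-1` [set x] = set0) ?nu0 ?mule0//.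
  by apply/seteqP; split=> // w /= swx; apply: xr; rewrite -swx.
rewrite -fsbig_seq// -sum_fine => [|x _]; last by rewrite fin_numM.
by apply: eq_bigr => x _; rewrite fineM.
Qed.

Lemma measurable_fiber s x : measurable_fun setT s -> measurable (s @^-1` [set x]).
Proof. by move=> ms; rewrite -[X in measurable X]setTI; apply: ms. Qed.

Lemma simple_fibers s : simple s ->
  exists r : seq R, [/\ uniq r, forall w, s w \in r &
    forall x, measurable (s @^-1` [set x])].
Proof.
move=> /simpleP[ms /finite_seqP[r sr]]; exists (undup r); split.
- exact: undup_uniq.
- by move=> w; rewrite mem_undup; have : range s (s w) by []; rewrite sr.
- by move=> x; exact: measurable_fiber.
Qed.

Lemma sintegral_linear nu : (forall A, measurable A -> nu A \is a fin_num) ->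
  fin_additive (fine \o nu) ->
  linear_on (@simple d T R) (fun s => fine (sintegral nu s)).
Proof.
move=> fnu anu a s t ss st.
have nu0 : nu set0 = 0.
  by rewrite -(fineK (fnu _ measurable0)); congr EFin; exact: (fin_additive0 anu).
have [r [ur sr ms]] := simple_fibers ss; have [q [uq tq mt]] := simple_fibers st.
(* Over the fibers of the pair, the integrals of [s], [t] and [a *: s + t] are finite sums with the
   same weights. *)
pose f w := (s w, t w); pose rq := [seq (x, y) | x <- r, y <- q].
have mf k : measurable (f @^-1` [set k]).
  rewrite (_ : _ @^-1` _ = s @^-1` [set k.1] `&` t @^-1` [set k.2]); first exact: measurableI.
  by case: k => x y; apply/seteqP; split=> w /= -[<- <-].
have frq w : f w \in rq by apply: allpairs_f.
have urq : uniq rq by rewrite allpairs_uniq// => -[? ?] [? ?].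
have key (phi : R * R -> R) : measurable_fun setT (phi \o f) ->
    fine (sintegral nu (phi \o f)) =
    (\sum_(k <- rq) phi k * fine (nu (f @^-1` [set k])))%R.
  move=> mphi; rewrite -(sum_fiber phi anu mf urq frq).
  rewrite (@fine_sintegral_seq _ _ (undup (map phi rq)))// ?undup_uniq//.
    by move=> x; apply: fnu; exact: measurable_fiber.
  by move=> w; rewrite mem_undup; apply: map_f.
have [ms' _] := (simpleP s).1 ss; have [mt' _] := (simpleP t).1 st.
rewrite (key (fun k => a * k.1 + k.2)%R); last first.
  by apply: measurable_funD => //; exact: measurable_funM.
rewrite (key fst)// (key snd)// mulr_sumr -big_split; apply: eq_bigr => k _ /=.
by rewrite mulrDl mulrA.
Qed.

Lemma sum_indic s (r : seq R) : uniq r -> (forall w, s w \in r) ->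
  s = (\sum_(x <- r) x *: (\1_(s @^-1` [set x]) : T -> R))%R.
Proof.
move=> ur sr; apply/funext => w; rewrite fct_sumE.
rewrite (bigD1_seq (s w))//= big1 ?addr0; last first.
  move=> x xs; rewrite fctE indicE memNset ?scaler0//= => e.
  by move: xs; rewrite e eqxx.
by rewrite fctE indicE mem_set// [RHS]mulr1.
Qed.

End finitely_additive.

(** * Riesz decomposition by pointwise clipping *)

Section clipping.
Context {R : realType}.
Implicit Types x y z : R.
Local Open Scope ring_scope.

(** Truncation of [x] to [[- |y|, |y|]]. It does not reverse the sign of [x], so that [|x|] is
    exactly the sum of the absolute values of [clip x y] and of the remainder. *)
Definition clip x y : R := Num.max (- `|y|) (Num.min x `|y|).

Lemma normr_clip x y : `|clip x y| = Num.min `|x| `|y|.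
Proof.
rewrite /clip /Num.min /Num.max; have y0 := normr_ge0 y.
case: (lerP 0 x) => x0; rewrite ?(ger0_norm x0) ?(ltr0_norm x0);
  repeat case: ifPn; rewrite -?leNgt => *;
  by [lra|rewrite ger0_norm; lra|rewrite ler0_norm; lra].
Qed.

Lemma normrB_clip x y : `|x - clip x y| = `|x| - Num.min `|x| `|y|.
Proof.
rewrite /clip /Num.min /Num.max; have y0 := normr_ge0 y.
case: (lerP 0 x) => x0; rewrite ?(ger0_norm x0) ?(ltr0_norm x0);
  repeat case: ifPn; rewrite -?leNgt => *;
  by [lra|rewrite ger0_norm; lra|rewrite ler0_norm; lra].
Qed.

(** The Riesz decomposition property: [x], dominated by [y + z], is [clip x y], dominated by [y],
    plus a remainder dominated by [z]. *)
Lemma normrB_clip_le x y z : `|x| <= `|y + z| -> `|x - clip x y| <= `|z|.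
Proof.
move=> h; rewrite normrB_clip lerBlDr; have := ler_normD y z; have := normr_ge0 z.
by rewrite /Num.min; case: ifP => _; lra.
Qed.

End clipping.

(** * Bounded functionals on L^oo and their absolute values *)

Section functionals_on_Linf.
Context {d : measure_display} {T : measurableType d} {R : realType}.
Variable P : probability T R.
Implicit Types (u v : T -> R).

Lemma measurable_clip u v : measurable_fun setT u -> measurable_fun setT v ->
  measurable_fun setT (fun w => clip (u w) (v w)).
Proof.
move=> mu mv; have mnv : measurable_fun setT (fun w => `|v w|%R).
  exact: measurableT_comp.
apply: measurable_maxr; first exact: measurable_funN.
exact: measurable_minr.
Qed.

(* The extended seminorm [u |-> \int |u| d|m|] attached to the functional
   [F = \int . dm]; [rho_m] is the case [F = int_Linf m]. *)
Definition absfun (F : (T -> R) -> R) u : \bar R :=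
  ereal_sup [set (F v)%:E | v in
    [set v | Linf P v /\ (\forall w \ae P, (`|v w| <= `|u w|)%R)]].

Context (F : (T -> R) -> R) (C : R).
Hypotheses (C0 : (0 <= C)%R) (lF : linear_on (Linf P) F).
Hypothesis bF : bounded_on (Linf P) (fun u => 'N[P]_+oo[EFin \o u]) C F.
Let sL := subspace_Linf P.
Let p := absfun F.

Lemma Linf_functional_le u (k : R) : Linf P u ->
  (\forall w \ae P, (`|u w| <= k)%R) -> (`|F u| <= C * k)%R.
Proof.
move=> Lu uk; rewrite -lee_fin EFinM (le_trans (bF Lu))//.
by apply: lee_wpmul2l; rewrite ?lee_fin//; exact/Linf_norm_le.
Qed.

Lemma Linf_functional_ae u v : Linf P u -> Linf P v ->
  (\forall w \ae P, u w = v w) -> F u = F v.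
Proof.
move=> Lu Lv uv; apply/eqP; rewrite -subr_eq0 -(linear_onB sL lF)//.
rewrite -normr_le0 -(mulr0 C) Linf_functional_le//; first exact: subspaceB.
by apply: filterS uv => w; rewrite !fctE => ->; rewrite subrr normr0.
Qed.

Lemma absfun_ge0 u : 0 <= p u.
Proof.
apply: ereal_sup_ubound; exists (fun=> 0%R); last by rewrite (linear_on0 sL lF).
by split; [exact: Linf_cst|apply: nearW => w; rewrite normr0].
Qed.

Lemma le_absfun u v : (\forall w \ae P, (`|u w| <= `|v w|)%R) -> p u <= p v.
Proof.
move=> uv; apply: ereal_sup_le => _ [f [Lf fu] <-]; exists f => //; split => //.
by apply: filterS2 fu uv => w; exact: le_trans.
Qed.

Lemma eq_absfun u v : (\forall w \ae P, `|u w|%R = `|v w|%R) -> p u = p v.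
Proof.
move=> uv; apply/eqP; rewrite eq_le !le_absfun//.
all: by apply: filterS uv => w ->.
Qed.

Lemma absfun_norm u : p (fun w => `|u w|%R) = p u.
Proof. by apply: eq_absfun; apply: nearW => w; rewrite normr_id. Qed.

Lemma absfun_ub u v : Linf P v -> (\forall w \ae P, (`|v w| <= `|u w|)%R) ->
  (`|F v|)%:E <= p u.
Proof.
move=> Lv vu; have [Fv|/ltW Fv] := leP 0%R (F v).
  by rewrite ger0_norm//; apply: ereal_sup_ubound; exists v.
rewrite ler0_norm// -(linear_onN sL lF)//; apply: ereal_sup_ubound.
exists (- v)%R => //; split; first exact: subspaceN.
by apply: filterS vu => w; rewrite !fctE normrN.
Qed.

Lemma absfun_self v : Linf P v -> (`|F v|)%:E <= p v.
Proof. by move=> Lv; apply: absfun_ub => //; exact: nearW. Qed.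

Lemma absfun_le u (k : R) : (\forall w \ae P, (`|u w| <= k)%R) -> p u <= (C * k)%:E.
Proof.
move=> uk; apply: ge_ereal_sup => _ [v [Lv vu] <-]; rewrite lee_fin.
rewrite (le_trans (ler_norm _))// Linf_functional_le//.
by apply: filterS2 vu uk => w; exact: le_trans.
Qed.

Lemma absfun_Linf_lty u : Linf P u -> p u < +oo.
Proof.
by move=> /Linf_ae_bound[k _ /absfun_le/le_lt_trans]; apply; exact: ltry.
Qed.

Lemma absfunZ a u : p (a *: u)%R = `|a|%:E * p u.
Proof.
have ge (b : R) v : `|b|%:E * p v <= p (b *: v)%R.
  have [->|b0] := eqVneq b 0%R; first by rewrite normr0 mul0e absfun_ge0.
  have nb0 : (0 < `|b|)%R by rewrite normr_gt0.
  rewrite muleC -lee_pdivlMr//; apply: ge_ereal_sup => _ [f [Lf fv] <-].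
  rewrite lee_pdivlMr// -EFinM; apply: ereal_sup_ubound.
  exists (`|b| *: f)%R; last by rewrite (linear_onZ sL lF)// mulrC.
  split; first exact: subspaceZ.
  by apply: filterS fv => w fvw; rewrite !fctE !normrM normr_id ler_wpM2l.
apply/eqP; rewrite eq_le ge andbT.
have [->|a0] := eqVneq a 0%R.
  rewrite normr0 mul0e scale0r (le_trans (absfun_le (k := 0%R) _))// ?mulr0//.
  by apply: nearW => w; rewrite normr0.
have na0 : (0 < `|a|)%R by rewrite normr_gt0.
rewrite muleC -lee_pdivrMr// muleC -normrV ?unitfE//.
by rewrite (le_trans (ge _ _))// scalerA mulVf// scale1r.
Qed.

(** A competitor [f] for [u + v] splits into [clip f u], a competitor for [u], and [f - clip f u], a
    competitor for [v]. *)
Lemma absfunD u v : measurable_fun setT u ->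
  p (u + v)%R <= p u + p v.
Proof.
move=> mu; apply: ge_ereal_sup => _ [f [Lf fuv] <-].
pose g w := clip (f w) (u w).
have mg : measurable_fun setT g.
  by apply: measurable_clip => //; exact: Linf_measurable Lf.
have Lg : Linf P g.
  apply: (Linf_ae_dominated mg Lf); apply: nearW => w.
  by rewrite normr_clip ge_min lexx.
rewrite -[f](subrK g) addrC (linear_onD lF)//; last exact: subspaceB.
rewrite EFinD leeD// ereal_sup_ubound//.
- exists g => //; split => //; apply: nearW => w.
  by rewrite normr_clip ge_min lexx orbT.
- exists (f - g)%R => //; split; first exact: subspaceB.
  by apply: filterS fuv => w; rewrite !fctE => /normrB_clip_le.
Qed.

(** Competitors for [u] and [v] add up to one for [u + v], because [|u| + |v| = |u + v|] for
    nonnegative functions. Finiteness is settled beforehand so that the two suprema can be taken one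
    after the other by subtraction. *)
Lemma absfun_superadditive u v :
  (forall w, (0 <= u w)%R) -> (forall w, (0 <= v w)%R) -> p u + p v <= p (u + v)%R.
Proof.
move=> u0 v0.
have [->|fin] := eqVneq (p (u + v)%R) +oo; first exact: leey.
have le1 : p u <= p (u + v)%R.
  by apply: le_absfun; apply: nearW => w; rewrite !fctE !ger0_norm ?addr_ge0 ?lerDl.
have le2 : p v <= p (u + v)%R.
  by apply: le_absfun; apply: nearW => w; rewrite !fctE !ger0_norm ?addr_ge0 ?lerDr.
have finuv : p (u + v)%R \is a fin_num.
  by rewrite ge0_fin_numE ?absfun_ge0// lt_neqAle fin leey.
have finu : p u \is a fin_num.
  by rewrite ge0_fin_numE ?absfun_ge0// (le_lt_trans le1)// ltey_eq finuv.
have finv : p v \is a fin_num.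
  by rewrite ge0_fin_numE ?absfun_ge0// (le_lt_trans le2)// ltey_eq finuv.
rewrite -leeBrDr//; apply: ge_ereal_sup => _ [f [Lf fu] <-].
rewrite leeBrDr// addeC -leeBrDr//; apply: ge_ereal_sup => _ [g [Lg gv] <-].
rewrite leeBrDr// -EFinD addrC -(linear_onD lF)//; apply: ereal_sup_ubound.
exists (f + g)%R => //; split; first exact: subspaceD.
apply: filterS2 fu gv => w; rewrite !fctE (ger0_norm (u0 w)) (ger0_norm (v0 w)).
by move=> fu gv; rewrite [leRHS]ger0_norm ?addr_ge0// (le_trans (ler_normD _ _))// lerD.
Qed.

Lemma absfunD_ge0 u v : measurable_fun setT u ->
  (forall w, (0 <= u w)%R) -> (forall w, (0 <= v w)%R) -> p (u + v)%R = p u + p v.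
Proof.
by move=> mu u0 v0; apply/eqP; rewrite eq_le absfunD//= absfun_superadditive.
Qed.

Lemma absfun_seminormed : seminormed (dom P p) p.
Proof.
have Z a u : p u < +oo -> p (a *: u)%R < +oo.
  move=> pu; rewrite absfunZ lte_mul_pinfty//.
have sd : is_subspace (dom P p).
  split.
    split; first exact: subspace0 (subspace_L1 P).
    by apply: absfun_Linf_lty; exact: Linf_cst.
  move=> a u v [Lu pu] [Lv pv]; split; first exact: (subspace_L1 P).2.
  have Lau := subspaceZ (subspace_L1 P) a Lu.
  rewrite (le_lt_trans (absfunD _ (L1_measurable Lau)))//.
  by apply: lte_add_pinfty => //; exact: Z.
split=> //.
- by move=> u _; exact: absfun_ge0.
- by move=> u [].
- by move=> a u _; exact: absfunZ.
- by move=> u v [Lu _] _; apply: absfunD; exact: L1_measurable Lu.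
Qed.

Lemma Linf_dom_absfun : Linf P `<=` dom P p.
Proof. by move=> u Lu; split; [exact: Linf_L1|exact: absfun_Linf_lty]. Qed.

(** Let [v] nearly attain [p u] and let [g] be [u] clipped by [v]. Then [|g| = |v|] almost
    everywhere, so [p g >= F v > p u - e], and additivity, [p u = p |g| + p |u - g|], leaves less
    than [e] for [u - g]. *)
Lemma dense_Linf_absfun : dense_in (dom P p) p (Linf P).
Proof.
move=> u [Lu pu] e e0.
have pfin : p u \is a fin_num by rewrite ge0_fin_numE ?absfun_ge0.
have [_ [v [Lv vu] <-] hv] := ub_ereal_sup_adherent e0 pfin.
pose g w := clip (u w) (v w).
have mu := L1_measurable Lu; have mv := Linf_measurable Lv.
have mg : measurable_fun setT g by exact: measurable_clip.
have Lg : Linf P g.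
  apply: (Linf_ae_dominated mg Lv); apply: nearW => w.
  by rewrite normr_clip ge_min lexx orbT.
exists g => //.
pose g1 : T -> R := fun w => `|g w|%R; pose g2 : T -> R := fun w => `|(u - g)%R w|%R.
have mg1 : measurable_fun setT g1 by exact: measurableT_comp.
have g10 w : (0 <= g1 w)%R by exact: normr_ge0.
have g20 w : (0 <= g2 w)%R by exact: normr_ge0.
have e1 : p u = p g1 + p g2.
  rewrite -absfunD_ge0//.
  rewrite -absfun_norm; apply: eq_absfun; apply: nearW => w.
  rewrite !fctE /g1 /g2 !fctE /g normr_clip normrB_clip.
  by rewrite [in RHS]addrC subrK normr_id.
have -> : p (u - g)%R = p g2 by rewrite absfun_norm.
have pg2 : p g2 <= p u by rewrite e1 leeDr// absfun_ge0.
have pg2fin : p g2 \is a fin_num by rewrite ge0_fin_numE ?absfun_ge0// (le_lt_trans pg2).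
have vg1 : (F v)%:E <= p g1.
  rewrite absfun_norm (le_trans _ (absfun_ub Lv _)) ?lee_fin ?ler_norm//.
  by apply: filterS vu => w vuw; rewrite normr_clip le_min vuw lexx.
have pg1 : p g1 <= p u by rewrite e1 leeDl// absfun_ge0.
have pg1fin : p g1 \is a fin_num by rewrite ge0_fin_numE ?absfun_ge0// (le_lt_trans pg1).
have : p u - e%:E < p g1 := lt_le_trans hv vg1.
by rewrite lteBlDr// e1 lteD2lE.
Qed.

Lemma absfun_bound : bounded_on (Linf P) p 1 F.
Proof. by move=> u Lu; rewrite mul1e absfun_self. Qed.

Lemma cont_linear_ext_absfunP : let G := cont_linear_ext (Linf P) (dom P p) p F in
  [/\ forall u, Linf P u -> G u = F u, linear_on (dom P p) G &
      forall u, dom P p u -> (`|G u|)%:E <= p u].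
Proof.
have [h1 h2 h3] := cont_linear_extP absfun_seminormed ler01 sL
  Linf_dom_absfun dense_Linf_absfun lF absfun_bound.
by split=> // u /h3; rewrite mul1e.
Qed.

Let pos u : T -> R := fun w => Num.max (u w) 0%R.
Let neg u : T -> R := fun w => Num.max (- u w)%R 0%R.

(* [\int . d|m|] as a linear functional *)
Definition absfun_lin u : R := (fine (p (pos u)) - fine (p (neg u)))%R.

Let pos_ge0 u w : (0 <= pos u w)%R. Proof. by rewrite /pos le_max lexx orbT. Qed.
Let neg_ge0 u w : (0 <= neg u w)%R. Proof. by rewrite /neg le_max lexx orbT. Qed.
Let pos_neg u w : u w = (pos u w - neg u w)%R.
Proof. by rewrite /pos /neg /Num.max; case: ifPn; case: ifPn; rewrite -?leNgt; lra. Qed.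
Let pos_le u w : (`|pos u w| <= `|u w|)%R.
Proof.
rewrite ger0_norm// /pos ge_max normr_ge0 andbT; exact: ler_norm.
Qed.
Let neg_le u w : (`|neg u w| <= `|u w|)%R.
Proof. by rewrite ger0_norm// /neg ge_max normr_ge0 andbT -normrN ler_norm. Qed.

Let Lpos u : Linf P u -> Linf P (pos u).
Proof.
move=> Lu; apply: (Linf_ae_dominated _ Lu); last exact: nearW.
by apply: measurable_maxr => //; exact: Linf_measurable Lu.
Qed.

Let Lneg u : Linf P u -> Linf P (neg u).
Proof.
move=> Lu; apply: (Linf_ae_dominated _ Lu); last exact: nearW.
by apply: measurable_maxr => //; apply: measurable_funN; exact: Linf_measurable Lu.
Qed.

Lemma absfun_Linf_fin u : Linf P u -> p u \is a fin_num.
Proof. by move=> Lu; rewrite ge0_fin_numE ?absfun_ge0// absfun_Linf_lty. Qed.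

Let fineD u v : Linf P u -> Linf P v ->
  (forall w, (0 <= u w)%R) -> (forall w, (0 <= v w)%R) ->
  fine (p (u + v)%R) = (fine (p u) + fine (p v))%R.
Proof.
move=> Lu Lv u0 v0; rewrite absfunD_ge0//; last exact: Linf_measurable Lu.
by rewrite fineD// absfun_Linf_fin.
Qed.

(** Every representation of [u] as a difference of nonnegative functions gives the same value,
    because [pos u + b = a + neg u] and [p] is additive on both sides. Linearity then only requires
    a convenient representation of each combination. *)
Let absfun_lin_diff u a b : Linf P u -> Linf P a -> Linf P b ->
  (forall w, (0 <= a w)%R) -> (forall w, (0 <= b w)%R) ->
  (forall w, u w = a w - b w)%R -> absfun_lin u = (fine (p a) - fine (p b))%R.
Proof.
move=> Lu La Lb a0 b0 uab; rewrite /absfun_lin.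
have : (pos u + b = a + neg u)%R.
  by apply/funext => w; rewrite !fctE; have := pos_neg u w; rewrite uab; lra.
move=> /(congr1 (fun f => fine (p f))).
by rewrite !fineD//; [lra|exact: Lneg|exact: Lpos].
Qed.

Lemma absfun_lin_linear : linear_on (Linf P) absfun_lin.
Proof.
have Z a u : Linf P u -> absfun_lin (a *: u)%R = (a * absfun_lin u)%R.
  move=> Lu; have Lp := Lpos Lu; have Ln := Lneg Lu.
  have [a0|/ltW a0] := leP 0%R a.
    rewrite (@absfun_lin_diff _ (a *: pos u) (a *: neg u))%R//.
    - by rewrite !absfunZ ger0_norm// !fineM ?absfun_Linf_fin//= mulrBr.
    - exact: (subspaceZ sL).
    - exact: (subspaceZ sL).
    - exact: (subspaceZ sL).
    - by move=> w; rewrite fctE mulr_ge0.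
    - by move=> w; rewrite fctE mulr_ge0.
    - by move=> w; rewrite !fctE [u w]pos_neg; exact: mulrBr.
  rewrite (@absfun_lin_diff _ (- a *: neg u) (- a *: pos u))%R//.
  - rewrite !absfunZ normrN ler0_norm// !fineM ?absfun_Linf_fin//=.
    by rewrite /absfun_lin; ring.
  - exact: (subspaceZ sL).
  - exact: (subspaceZ sL).
  - exact: (subspaceZ sL).
  - by move=> w; rewrite fctE mulr_ge0// oppr_ge0.
  - by move=> w; rewrite fctE mulr_ge0// oppr_ge0.
  - move=> w; rewrite !fctE [u w]pos_neg.
    by rewrite scalerBr !scaleNr opprK addrC.
move=> a u v Lu Lv; rewrite -Z//; have := subspaceZ sL a Lu.
move: (a *: u)%R => {Lu}u Lu.
rewrite (@absfun_lin_diff _ (pos u + pos v) (neg u + neg v))%R//.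
- by rewrite !fineD//; [rewrite /absfun_lin; ring|exact: Lneg|exact: Lneg|exact: Lpos|exact: Lpos].
- exact: (subspaceD sL).
- by apply: (subspaceD sL); exact: Lpos.
- by apply: (subspaceD sL); exact: Lneg.
- by move=> w; rewrite fctE addr_ge0.
- by move=> w; rewrite fctE addr_ge0.
- by move=> w; rewrite !fctE [u w]pos_neg [v w]pos_neg; ring.
Qed.

Lemma absfun_lin_nneg u : Linf_nneg P u -> absfun_lin u = fine (p u).
Proof.
move=> [Lu u0]; rewrite /absfun_lin (_ : p (neg u) = 0) ?subr0.
  congr fine; apply: eq_absfun; apply: filterS u0 => w u0.
  by rewrite /pos max_l.
apply/eqP; rewrite eq_le absfun_ge0 andbT (le_trans (absfun_le (k := 0%R) _)) ?mulr0//.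
by apply: filterS u0 => w u0; rewrite /neg max_r ?normr0// oppr_le0.
Qed.

Lemma absfun_lin_bound :
  bounded_on (Linf P) (fun u => 'N[P]_+oo[EFin \o u]) (2 * C)%R absfun_lin.
Proof.
move=> u Lu; rewrite (seminormedE (Linf_seminormed P) Lu).
set k := fine _; have hk : \forall w \ae P, (`|u w| <= k)%R.
  by apply/Linf_norm_le; rewrite (seminormedE (Linf_seminormed P) Lu).
have h v : Linf P v -> (forall w, `|v w| <= `|u w|)%R -> (`|fine (p v)| <= C * k)%R.
  move=> Lv vu; rewrite ger0_norm ?fine_ge0 ?absfun_ge0//.
  rewrite -lee_fin fineK ?absfun_Linf_fin//; apply: absfun_le.
  by apply: filterS hk => w; exact: le_trans.
rewrite -EFinM lee_fin (le_trans (ler_normB _ _))// -mulrA mulr_natl mulr2n lerD//.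
- by apply: h => //; exact: Lpos.
- by apply: h => //; exact: Lneg.
Qed.

End functionals_on_Linf.

(** * The integral against a finitely additive measure and its variation *)

Section integration_on_Linf.
Context {d : measure_display} {T : measurableType d} {R : realType}.
Variable P : probability T R.
Implicit Types (u v s : T -> R) (nu : set T -> \bar R).
Let sL := subspace_Linf P.
Let Ninf u := 'N[P]_+oo[EFin \o u].

(** [nu] is an arbitrary set function here, known only through [G] on indicators. This allows
    [int_Linf] to be computed at [variation_div m b], which is a bare function and not packaged as a
    charge. *)
Lemma int_Linf_unique nu (G : (T -> R) -> R) :
  linear_on (Linf P) G -> continuous_on (Linf P) Ninf G ->
  (forall A, measurable A -> nu A = (G (\1_A))%:E) ->
  forall u, Linf P u -> int_Linf P nu u = G u.
Proof.
move=> lG cG nuG.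
apply: (cont_linear_ext_unique (Linf_seminormed P)) => //.
- by move=> s; exact: simple_Linf.
- exact: dense_simple.
move=> s ss; have [r [ur sr ms]] := simple_fibers ss.
have nu0 : nu set0 = 0 by rewrite nuG// indic0 (linear_on0 sL lG).
rewrite (@fine_sintegral_seq _ _ _ nu s r)// => [|x]; last by rewrite nuG.
rewrite [in LHS](sum_indic ur sr).
have : forall q, Linf P (\sum_(x <- q) x *: (\1_(s @^-1` [set x]) : T -> R))%R /\
   G (\sum_(x <- q) x *: (\1_(s @^-1` [set x]) : T -> R))%R =
   (\sum_(x <- q) x * fine (nu (s @^-1` [set x])))%R.
  elim=> [|x q [Lq ihq]]; first by rewrite !big_nil (linear_on0 sL lG); split=> //; exact: sL.1.
  rewrite !big_cons lG ?ihq ?nuG//; last exact: Linf_indic.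
  by split=> //; apply: sL.2 => //; exact: Linf_indic.
by move=> /(_ r)[].
Qed.

Lemma int_Linf_continuous_indic nu (G : (T -> R) -> R) (C : R) :
  linear_on (Linf P) G -> bounded_on (Linf P) Ninf C G ->
  (forall A, measurable A -> nu A = (G (\1_A))%:E) ->
  forall u, Linf P u -> int_Linf P nu u = G u.
Proof.
move=> lG bG; apply: int_Linf_unique => //.
exact: (bounded_continuous (Linf_seminormed P) lG bG).
Qed.

Section additive_charge.
Variable m : {additive_charge set T -> \bar R}%R.
Hypothesis Mm : M1 P m.

Lemma additive_charge_fin_num A : measurable A -> m A \is a fin_num.
Proof. by move=> mA; exact: fin_num_measure. Qed.

Lemma additive_charge0 : m set0 = 0.
Proof.
have /[!big_ord0] -> // := @charge_semi_additive _ _ _ m (fun=> set0) 0%N.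
exact: trivIset_set0.
Qed.

Lemma additive_charge_fin_additive : fin_additive (fine \o m).
Proof.
move=> A B mA mB AB /=; have := semi_additiveW additive_charge0 (@charge_semi_additive _ _ _ m).
by move=> ->//; [rewrite fineD//; exact: additive_charge_fin_num|exact: measurableU].
Qed.

Lemma M1_null A : measurable A -> P A = 0 -> fine (m A) = 0%R.
Proof.
have [/null_content_dominatesP mP _] := Mm.
by move=> mA PA; rewrite mP.
Qed.

(** The bound on [s] holds only almost everywhere. Where it fails, off [A] or at values larger than
    [M], the pieces of the level sets are [P]-null, hence [m]-null by absolute continuity; the other
    cells fall under [fin_additive_le_variation]. *)
Lemma sintegral_le_variation s A (M a b : R) : simple s -> measurable A ->
  (0 <= M)%R -> (\forall w \ae P, (`|s w| <= M * \1_A w)%R) ->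
  (forall B, measurable B -> B `<=` A -> (fine (m B) <= a)%R) ->
  (forall B, measurable B -> B `<=` A -> (- fine (m B) <= b)%R) ->
  (fine (sintegral m s) <= M * (a + b))%R.
Proof.
move=> ss mA M0 sM ma mb; have [r [ur sr ms]] := simple_fibers ss.
have am := additive_charge_fin_additive.
have mfin x : m (s @^-1` [set x]) \is a fin_num by exact: additive_charge_fin_num.
have m0 := additive_charge0.
have null B : measurable B -> (forall w, B w -> ~ (`|s w| <= M * \1_A w)%R) ->
    fine (m B) = 0%R.
  move=> mB hB; apply: M1_null => //; apply: measure_negligible => //.
  by apply: negligibleS sM.
rewrite (@fine_sintegral_seq _ _ _ m s r)//.
pose E x := s @^-1` [set x] `&` A.
have mE x : measurable (E x) by exact: measurableI.
rewrite (eq_bigr (fun x => x * fine (m (E x))))%R => [|x _]; last first.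
  have [->|x0] := eqVneq x 0%R; first by rewrite !mul0r.
  congr (_ * _)%R; rewrite -[X in m X](setUIDK _ A).
  have mD : measurable (s @^-1` [set x] `\` A) by exact: measurableD.
  have := am _ _ (mE x) mD; rewrite /= -/(E x) => ->; last first.
    by apply/seteqP; split=> // w [[_ Aw] [_]].
  rewrite [X in (_ + X)%R]null ?addr0// => w [/= sw nA].
  by rewrite indicE memNset// mulr0 normr_le0 sw (negbTE x0).
apply: (@fin_additive_le_variation _ _ _ _ E r ur mE _ _ am id A) => //.
- move=> x y xy; apply/seteqP; split=> // w [[/= sx _] [/= sy _]].
  by move: xy; rewrite -sx -sy eqxx.
- by move=> x w [].
move=> x; have [xM|xM] := leP `|x|%R M; [by left|right].
apply: null => // w [/= sw Aw]; rewrite indicE mem_set// mulr1 sw.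
by apply/negP; rewrite -ltNge.
Qed.

(** A bound [K] on the values of [m] bounds its positive and its negative variation alike, whence
    the constant [2 * K]. *)
Lemma int_LinfP : exists C : R, [/\ (0 <= C)%R,
  forall s, simple s -> int_Linf P m s = fine (sintegral m s),
  linear_on (Linf P) (int_Linf P m) & bounded_on (Linf P) Ninf C (int_Linf P m)].
Proof.
have [_ [K mK]] := Mm.
have K0 : (0 <= K)%R.
  by rewrite -lee_fin; apply: le_trans (mK _ measurable0); exact: abse_ge0.
have mK' B : measurable B -> (`|fine (m B)| <= K)%R.
  move=> mB; rewrite -lee_fin; have := mK _ mB.
  by rewrite -[m B in X in X -> _](fineK (additive_charge_fin_num mB)).
have lI : linear_on (@simple d T R) (fun s => fine (sintegral m s)).
  exact: (sintegral_linear additive_charge_fin_num additive_charge_fin_additive).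
have bI : bounded_on (@simple d T R) Ninf (2 * K)%R (fun s => fine (sintegral m s)).
  move=> s ss; have Ls := simple_Linf P ss.
  rewrite /Ninf (seminormedE (Linf_seminormed P) Ls); set k := fine 'N[P]_+oo[EFin \o s].
  have k0 : (0 <= k)%R by rewrite fine_ge0// Lnorm_ge0.
  have hk : \forall w \ae P, (`|s w| <= k)%R.
    by apply/Linf_norm_le; rewrite (seminormedE (Linf_seminormed P) Ls).
  have h t : simple t -> (\forall w \ae P, (`|t w| <= k)%R) ->
      (fine (sintegral m t) <= k * (K + K))%R.
    move=> st tk; apply: (@sintegral_le_variation _ setT) => //.
    - by apply: filterS tk => w; rewrite indicE in_setT mulr1.
    - by move=> B mB _; rewrite (le_trans (ler_norm _))// mK'.
    - by move=> B mB _; rewrite (le_trans (ler_norm _))// normrN mK'.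
  rewrite -EFinM lee_fin (_ : 2 * K * k = k * (K + K))%R; last by ring.
  rewrite ler_norml lerNl h// andbT -(linear_onN (subspace_simple) lI)// h//.
    exact: (subspaceN (subspace_simple)).
  by apply: filterS hk => w; rewrite fctE normrN.
have K2 : (0 <= 2 * K)%R by rewrite mulr_ge0.
have simL : @simple d T R `<=` Linf P by move=> s; exact: simple_Linf.
have [h1 h2 h3] := cont_linear_extP (Linf_seminormed P) K2 subspace_simple simL
  (@dense_simple _ _ _ P) lI bI.
by exists (2 * K)%R; split.
Qed.

Lemma fine_sintegral_indic A : measurable A -> fine (sintegral m \1_A) = fine (m A).
Proof.
move=> mA; have am := additive_charge_fin_additive.
have m0 := additive_charge0.
rewrite (@fine_sintegral_seq _ _ _ m \1_A [:: 0%R; 1%R])//.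
- rewrite !big_cons big_nil mul0r mul1r addr0 add0r.
  congr (fine (m _)); apply/seteqP; split=> w /=; rewrite indicE.
    by case: (boolP (w \in A)) => [/set_mem//|_ /eqP]; rewrite eq_sym oner_eq0.
  by move=> Aw; rewrite mem_set.
- move=> x; apply: additive_charge_fin_num; apply: measurable_fiber.
  exact: measurable_indic.
- by rewrite /= inE eq_sym oner_eq0.
- by move=> w; rewrite indicE; case: (_ \in _); rewrite !inE eqxx ?orbT.
Qed.

Lemma int_Linf_indic A : measurable A -> int_Linf P m \1_A = fine (m A).
Proof.
move=> mA; have [C [_ h _ _]] := int_LinfP.
by rewrite h ?fine_sintegral_indic//; exact: simple_indic.
Qed.

(** Bridge between the variation of sets and the functional [absfun]. From below, the test functions
    are [\1_B - \1_D] with [B] and [D] inside [A]; from above, a test function is approximated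
    uniformly by simple ones supported in [A], where finite sums suffice. *)
Lemma rho_m_indic A : measurable A -> rho_m P m \1_A = Defs.variation m A.
Proof.
move=> mA; have [C [C0 hs lF bF]] := int_LinfP.
have rmE : rho_m P m = absfun P (int_Linf P m) by [].
have mfin B : measurable B -> m B \is a fin_num by exact: additive_charge_fin_num.
have LA := Linf_indic P mA.
apply/eqP; rewrite eq_le; apply/andP; split; last first.
  have sup_fin (S : set (\bar R)) (k : R) : S 0 -> (forall x, S x -> x <= k%:E) ->
      ereal_sup S \is a fin_num.
    move=> S0 Sk; rewrite ge0_fin_numE; last exact: ereal_sup_ubound.
    by apply: le_lt_trans (ltry k); exact: ge_ereal_sup.
  have m0 := additive_charge0.
  have key B D : measurable B -> measurable D -> B `<=` A -> D `<=` A ->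
      m B - m D <= rho_m P m \1_A.
    move=> mB mD BA DA; rewrite -(fineK (mfin _ mB)) -(fineK (mfin _ mD)) -EFinB.
    rewrite -!int_Linf_indic// -(linear_onB sL lF); [|exact: Linf_indic|exact: Linf_indic].
    apply: ereal_sup_ubound; exists (\1_B - \1_D)%R => //; split.
      by apply: (subspaceB sL); exact: Linf_indic.
    apply: nearW => w; rewrite !fctE !indicE.
    have [wA|/negP wA] := boolP (w \in A).
      rewrite normr1; case: (w \in B); case: (w \in D) => /=;
        by rewrite ?subrr ?subr0 ?sub0r ?normrN ?normr0 ?normr1.
    have /negbTE-> : w \notin B by apply: contra_notN wA => /set_mem/BA/mem_set.
    have /negbTE-> : w \notin D by apply: contra_notN wA => /set_mem/DA/mem_set.
    by rewrite subrr.
  have rfin : rho_m P m \1_A \is a fin_num by rewrite rmE (absfun_Linf_fin C0 lF bF LA).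
  have [/= _ [K mK]] := Mm.
  have nfin : neg_variation m A \is a fin_num.
    apply: (@sup_fin _ K); first by exists set0; [split|rewrite m0 oppe0].
    move=> _ [B [mB _] <-]; rewrite (le_trans _ (mK _ mB))//.
    by rewrite -abseN lee_abs.
  rewrite /Defs.variation/= -leeBrDr//; apply: ge_ereal_sup => _ [B [mB BA] <-].
  rewrite leeBrDr// addeC -leeBrDr//; last exact: mfin.
  apply: ge_ereal_sup => _ [D [mD DA] <-].
  by rewrite leeBrDr ?mfin// addeC key.
have vfin : Defs.variation m A \is a fin_num \/ Defs.variation m A = +oo.
  have : 0 <= Defs.variation m A.
    have m0 := additive_charge0.
    by apply: adde_ge0; apply: ereal_sup_ubound; exists set0; rewrite ?m0 ?oppe0//; split.
  by case: (Defs.variation m A) => [r _|_|//]; [left|right].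
case: vfin => [vfin|->]; last exact: leey.
move: (vfin); rewrite /Defs.variation /= fin_numD => /andP[pfin nfin].
apply: ge_ereal_sup => _ [v [Lv vA] <-].
set a := fine (pos_variation m A); set b := fine (neg_variation m A).
rewrite -(fineK pfin) -(fineK nfin) -EFinD lee_fin -/a -/b.
have ha B : measurable B -> B `<=` A -> (fine (m B) <= a)%R.
  move=> mB BA; rewrite -lee_fin (fineK (mfin _ mB)) /a (fineK pfin).
  by apply: ereal_sup_ubound; exists B.
have hb B : measurable B -> B `<=` A -> (- fine (m B) <= b)%R.
  move=> mB BA; rewrite -lee_fin EFinN (fineK (mfin _ mB)) /b (fineK nfin).
  by apply: ereal_sup_ubound; exists B.
apply/ler_addgt0Pr => e e0.
(* Replacing [v] by [t] costs [C * (e / q)], and the bound on [t] exceeds 1 by [e / q], which costs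
   [e / q * (a + b)]; [q] dominates [C + (a + b)]. *)
pose q := (C + `|a + b| + 1)%R; have q0 : (0 < q)%R by rewrite ltr_wpDl// addr_ge0.
have eq0 : (0 < e / q)%R by rewrite divr_gt0.
have [s ss hvs] := dense_simple Lv eq0.
have {}hvs : \forall w \ae P, (`|(v - s)%R w| <= e / q)%R by apply/Linf_norm_le/ltW.
(* Multiplying by [\1_A] is harmless because [v] vanishes almost everywhere off [A]; it puts [t]
   under the variation on [A] alone. *)
pose t : T -> R := (s * \1_A)%R.
have st : simple t.
  have [ms fs] := (simpleP s).1 ss; have [m1 f1] := (simpleP (\1_A : T -> R)).1 (simple_indic mA).
  apply/simpleP; split; first exact: measurable_funM.
  exact: (@finite_set_range2 _ _ _ s \1_A (fun x y => x * y)%R fs f1).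
have Lt := simple_Linf P st.
have h1 : (fine (sintegral m t) <= (1 + e / q) * (a + b))%R.
  apply: (sintegral_le_variation st mA) => //; first by rewrite addr_ge0// ltW.
  apply: filterS2 vA hvs => w vA hvs; rewrite /t fctE normrM.
  move: vA; rewrite indicE; case: (w \in A); last by rewrite normr0 !mulr0.
  rewrite normr1 !mulr1 => v1; rewrite (_ : s w = v w - (v - s)%R w)%R; last first.
    by rewrite !fctE; ring.
  by rewrite (le_trans (ler_normB _ _))// lerD.
have h2 : (`|int_Linf P m (v - t)%R| <= C * (e / q))%R.
  apply: (Linf_functional_le C0 bF); first exact: (subspaceB sL).
  apply: filterS2 vA hvs => w; rewrite /t !fctE indicE.
  case: (w \in A); first by rewrite mulr1.
  by rewrite normr0 normr_le0 => /eqP-> _; rewrite mulr0 subrr normr0 ltW.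
have : int_Linf P m v = (int_Linf P m (v - t) + fine (sintegral m t))%R.
  by rewrite (linear_onB sL lF)// (hs _ st) subrK.
move=> ->; rewrite (le_trans (lerD (le_trans (ler_norm _) h2) h1))//.
suff : (e / q * (C + (a + b)) <= e)%R by lra.
rewrite -[leRHS](divfK (lt0r_neq0 q0)) ler_wpM2l ?(ltW eq0)// /q.
by have := ler_norm (a + b)%R; lra.
Qed.

(** By [rho_m_indic], [|m| / b] has on measurable sets the values of [b^-1 * absfun_lin] at
    indicators, and this functional is linear and bounded on [L^oo]. Thus [alpha] at [|m| / b] can
    be computed from [rho_m] and [rho]. *)
Lemma int_Linf_variation_div (b : R) u : (0 < b)%R -> Linf_nneg P u ->
  int_Linf P (variation_div m b) u = (fine (rho_m P m u) / b)%R.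
Proof.
move=> b0 Lu; have [C [C0 hs lF bF]] := int_LinfP.
have lG := absfun_lin_linear C0 lF bF.
rewrite (@int_Linf_continuous_indic _
  (fun v => b^-1 * absfun_lin P (int_Linf P m) v)%R (b^-1 * (2 * C))%R).
- by rewrite (absfun_lin_nneg C0 lF bF)// mulrC.
- by move=> a v w Lv Lw; rewrite lG//; ring.
- move=> v Lv; rewrite normrM EFinM EFinM -muleA ger0_norm; last by rewrite invr_ge0 ltW.
  apply: lee_wpmul2l; first by rewrite lee_fin invr_ge0 ltW.
  exact: (absfun_lin_bound C0 lF bF).
- move=> A mA; rewrite /variation_div -rho_m_indic// (absfun_lin_nneg C0 lF bF).
    rewrite EFinM fineK//; exact: (absfun_Linf_fin C0 lF bF (Linf_indic P mA)).
  by split; [exact: Linf_indic|apply: nearW => w; rewrite indicE].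
- exact: Lu.1.
Qed.

End additive_charge.
End integration_on_Linf.

(** * Completeness of L^1 *)

Section L1_completeness.
Context {d : measure_display} {T : measurableType d} {R : realType}.
Variable P : probability T R.

(* Riesz-Fischer: a rapidly Cauchy subsequence converges almost surely, with
   integrable majorant [|v_0| + \sum_k |v_(k+1) - v_k|]. *)
Lemma complete_L1 : complete_on (L1 P) (fun u => 'N[P]_1[EFin \o u]).
Proof.
move=> u_ Lu_ cu_.
have s1 := subspace_L1 P; have sN := L1_seminormed P.
have half k : (0 < 1 / (2 ^ k.+1)%:R :> R)%R by rewrite divr_gt0// ltr0n expn_gt0.
have [phi hphi] := choice (fun k => cu_ _ (half k)).
(* The maximum makes [psi k] at least [phi j] for all [j <= k], so consecutive terms are within
   [1 / 2 ^ k.+1]; adding [k] makes [psi] tend to infinity. *)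
pose psi k := (\max_(j < k.+1) phi j + k)%N.
have psi_phi k j : (j <= k)%N -> (phi j <= psi k)%N.
  move=> jk; have jk' : (j < k.+1)%N by [].
  exact/(leq_trans _ (leq_addr _ _))/(@leq_bigmax _ (fun j : 'I_k.+1 => phi j) (Ordinal jk')).
pose v_ k := u_ (psi k).
have Lv_ k : L1 P (v_ k) by exact: Lu_.
have mv_ k : measurable_fun setT (v_ k) by exact: L1_measurable (Lv_ k).
have dv k : 'N[P]_1[EFin \o (v_ k.+1 - v_ k)%R] < (1 / (2 ^ k.+1)%:R)%:E.
  by apply: hphi; apply: psi_phi.
pose D k : T -> R := fun w => `|v_ k.+1 w - v_ k w|%R.
have mD k : measurable_fun setT (D k).
  by apply: measurableT_comp => //; exact: measurable_funB.
pose G w : \bar R := \sum_(k <oo) (D k w)%:E.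
have D0 k w : 0 <= (D k w)%:E by rewrite lee_fin /D.
have mG : measurable_fun setT G.
  by apply: ge0_emeasurable_sum => //= k _; exact/measurable_EFinP.
have intG : \int[P]_w G w <= 1%:E.
  rewrite integral_nneseries//; last by move=> k; exact/measurable_EFinP.
  apply: (@le_trans _ _ (\sum_(k <oo) (1 / (2 ^ k.+1)%:R)%:E)).
    apply: lee_nneseries => [k _ _|k _]; first by apply: integral_ge0 => w _; exact: D0.
    rewrite ltW//; apply: le_lt_trans (dv k).
    by rewrite Lnorm1 le_eqVlt; apply/orP; left; apply/eqP/eq_integral.
  exact: epsilon_trick0.
have iG : P.-integrable setT G.
  apply/integrableP; split => //.
  under eq_integral do rewrite gee0_abs ?nneseries_ge0//.
  by apply: le_lt_trans intG _; exact: ltry.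
have iv0 : P.-integrable setT (fun w => `|v_ 0%N w|%:E).
  by apply/L1_integrable; exact: L1_norm.
pose g w := `|v_ 0%N w|%:E + G w.
have ig : P.-integrable setT g by exact: integrableD.
(* The upper limit is defined and measurable everywhere; it is the limit of [v_] wherever [G] is
   finite. *)
pose f w := limn_esup (fun k => (v_ k w)%:E).
have mf : measurable_fun setT f.
  by apply: measurable_fun_limn_esup => k; exact/measurable_EFinP.
have Gfin : {ae P, forall w, G w \is a fin_num}.
  by apply: filterS (integrable_ae measurableT iG) => w; exact.
have partial w k : (\sum_(0 <= j < k) D j w)%:E <= G w.
  by rewrite -sumEFin; apply: nneseries_lim_ge => *.
have vfg w k : `|(v_ k w)%:E| <= g w.
  rewrite /g (le_trans _ (leeD (lexx _) (partial w k)))// -EFinD lee_fin.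
  have -> : v_ k w = (v_ 0%N w + \sum_(0 <= j < k) (v_ j.+1 w - v_ j w))%R.
    by rewrite (telescope_sumr (fun j => v_ j w))// addrC subrK.
  by rewrite (le_trans (ler_normD _ _))// lerD2l ler_norm_sum.
have vf : {ae P, forall w, setT w -> (v_ k w)%:E @[k --> \oo] --> f w}.
  apply: filterS Gfin => w Gw _.
  have cs : cvgn (series (fun j => v_ j.+1 w - v_ j w)%R).
    apply: normed_cvg; apply: nondecreasing_is_cvgn.
      exact: (@nondecreasing_series _ (fun j => `|v_ j.+1 w - v_ j w|%R) xpredT 0%N).
    exists (fine (G w)) => _ [k _ <-].
    by rewrite -lee_fin fineK//; exact: partial.
  have cv : cvgn (v_ ^~ w).
    have -> : v_ ^~ w = (fun k => v_ 0%N w + series (fun j => v_ j.+1 w - v_ j w) k)%R.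
      by apply/funext => k; rewrite /series/= telescope_sumr// addrC subrK.
    by apply: is_cvgD => //; exact: is_cvg_cst.
  have cE : (v_ k w)%:E @[k --> \oo] --> (limn (v_ ^~ w))%:E.
    by apply: cvg_EFin => //; exact: nearW.
  by rewrite /f is_cvg_limn_esupE; [rewrite (cvg_lim _ cE)|exact: cvgP cE].
have mv k : measurable_fun setT (EFin \o v_ k) by exact/measurable_EFinP.
have fg : {ae P, forall w k, setT w -> `|(EFin \o v_ k) w| <= g w}.
  by apply: nearW => w k _; exact: vfg.
have [iF cF _] := dominated_convergence measurableT mv mf vf ig fg.
have ffin : {ae P, forall w, f w \is a fin_num}.
  by apply: filterS (integrable_ae measurableT iF) => w; exact.
pose u w := fine (f w).
have mu : measurable_fun setT u.
  by apply: measurableT_comp => //; exact: measurable_fine.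
have Lu : L1 P u.
  apply/L1_integrable; apply: le_integrable iF => //; first exact/measurable_EFinP.
  by move=> w _; rewrite /u /=; case: (f w) => //= *; rewrite normr0 ?leey.
exists u => //.
have LB n : L1 P (u_ n - u)%R by exact: (subspaceB s1).
have LBv k : L1 P (v_ k - u)%R by exact: (subspaceB s1).
have vu k : 'N[P]_1[EFin \o (v_ k - u)%R] = \int[P]_w `|(v_ k w)%:E - f w|.
  rewrite Lnorm1; apply: ae_eq_integral => //.
  - apply: measurableT_comp => //; exact/measurable_EFinP/(L1_measurable (LBv k)).
  - by apply: measurableT_comp => //; exact: (emeasurable_funB (mv k) mf).
  - by apply: filterS ffin => w fw _; rewrite -[in RHS](fineK fw).
apply/fine_cvgP; split.
  by apply: nearW => n; rewrite (seminormedE sN (LB n)).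
apply/cvgrPdist_lt => e e0.
have e2 : (0 < e / 2)%R by rewrite divr_gt0.
have [n0 hn0] := cu_ _ e2.
move: cF => /fine_cvgP[_ /cvgrPdist_lt/(_ _ e2)[n1 _ hn1]].
exists n0 => // n /= nn0; rewrite sub0r normrN ger0_norm ?fine_ge0 ?Lnorm_ge0//.
pose k := maxn n0 n1.
rewrite -lte_fin -(seminormedE sN (LB n)).
have -> : (u_ n - u = (u_ n - v_ k) + (v_ k - u))%R by rewrite addrA subrK.
have LBn : L1 P (u_ n - v_ k)%R by exact: (subspaceB s1).
apply: le_lt_trans (seminormedD sN LBn (LBv k)) _.
rewrite [e]splitr EFinD lteD//.
  apply: hn0 => //; rewrite (leq_trans (leq_maxl n0 n1))//.
  exact: leq_addl.
have := hn1 k (leq_maxr _ _); rewrite /= sub0r normrN.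
rewrite -vu ger0_norm ?fine_ge0 ?Lnorm_ge0// (seminormedE sN (LBv k)).
by rewrite lte_fin.
Qed.

End L1_completeness.

(** * The space L^rho *)

Section risk_functional.
Context {d : measure_display} {T : measurableType d} {R : realType}.
Variables (P : probability T R) (rho : (T -> R) -> \bar R).

Record risk_functional : Prop := RiskFunctional {
  risk_convex : convex_L1 P rho;
  risk_nondecreasing : nondecreasing_L1 P rho;
  risk_0 : rho (fun=> 0%R) = 0;
  risk_translation : forall (xi : T -> R) (a : R), L1 P xi ->
    rho (fun w => xi w + a)%R = rho xi + a%:E;
  risk_lsc : lsc_L1 P rho }.

Hypothesis rhoP : risk_functional.
Let rho_convex := risk_convex rhoP.
Let rho_nondecreasing := risk_nondecreasing rhoP.
Let rho_0 := risk_0 rhoP.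
Let rho_translation := risk_translation rhoP.
Let rho_lsc := risk_lsc rhoP.
Implicit Types (u v : T -> R).
Let s1 := subspace_L1 P.

Lemma rho_cst (k : R) : rho (fun=> k) = k%:E.
Proof.
have := rho_translation k (L1_cst P 0%R); rewrite rho_0 add0e => <-.
by congr rho; apply/funext => w; rewrite add0r.
Qed.

Lemma rho_ge0 u : L1 P u -> (\forall w \ae P, (0 <= u w)%R) -> 0 <= rho u.
Proof. by move=> Lu u0; rewrite -rho_0; apply: rho_nondecreasing => //; exact: L1_cst. Qed.

Lemma rho_le_cst u (k : R) : L1 P u -> (\forall w \ae P, (`|u w| <= k)%R) ->
  rho u <= k%:E.
Proof.
move=> Lu uk; rewrite -rho_cst; apply: rho_nondecreasing => //; first exact: L1_cst.
by apply: filterS uk => w; exact/le_trans/ler_norm.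
Qed.

Lemma rho_scale u (t a : R) : L1 P u -> (0 < t <= 1)%R -> rho u <= a%:E ->
  rho (t *: u)%R <= (t * a)%:E.
Proof.
move=> Lu /andP[t0]; rewrite le_eqVlt => /orP[/eqP->|t1] ua.
  by rewrite scale1r mul1r.
have := rho_convex Lu (L1_cst P 0%R) ua (b := 0%R) _ (t := t).
rewrite rho_0 t0 t1 mulr0 addr0 => /(_ (lexx _) isT).
by congr (rho _ <= _); apply/funext => w; rewrite !fctE scaler0 addr0.
Qed.

Lemma rho_sublevel_closed u (a : R) : L1 P u ->
  (forall r : R, (0 < r)%R -> exists v, [/\ L1 P v,
     'N[P]_1[EFin \o (v - u)%R] < r%:E & rho v <= a%:E]) -> rho u <= a%:E.
Proof.
move=> Lu h; rewrite leNgt; apply/negP => /(rho_lsc Lu)[r r0 hr].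
have [v [Lv vr va]] := h r r0.
by have := hr v Lv vr; rewrite ltNge va.
Qed.

Lemma rho_abs_div_le u v (b b' : R) : L1 P u -> L1 P v -> (0 < b)%R -> (b <= b')%R ->
  (\forall w \ae P, (`|u w| <= `|v w|)%R) -> rho (abs_div u b') <= rho (abs_div v b).
Proof.
move=> Lu Lv b0 bb uv; apply: rho_nondecreasing; [exact: L1_abs_div|exact: L1_abs_div|].
apply: filterS uv => w uv; rewrite /abs_div.
rewrite ler_pM// ?invr_ge0 ?(le_trans (ltW b0))// lef_pV2// posrE.
exact: lt_le_trans bb.
Qed.

Lemma abs_div1 u : abs_div u 1 = (fun w => `|u w|%R).
Proof. by apply/funext => w; rewrite /abs_div divr1. Qed.

Lemma abs_div_scale u (b t : R) : abs_div u (b * t) = (t^-1 *: abs_div u b)%R.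
Proof.
by apply/funext => w; rewrite /abs_div fctE invfM [RHS]mulrC mulrA.
Qed.

Lemma rho_abs_div_scale u (b t a : R) : L1 P u -> (0 < b)%R -> (1 <= t)%R ->
  rho (abs_div u b) <= a%:E -> rho (abs_div u (b * t)) <= (a / t)%:E.
Proof.
move=> Lu b0 t1 h; have t0 : (0 < t)%R by exact: lt_le_trans t1.
rewrite abs_div_scale mulrC; apply: rho_scale => //; first exact: L1_abs_div.
by rewrite invr_gt0 t0 invf_le1.
Qed.

Lemma norm_rho_ge0 u : 0 <= norm_rho rho u.
Proof. by apply: le_ereal_inf_tmp => _ [b [/ltW b0 _] <-]; rewrite lee_fin. Qed.

Lemma norm_rho_lt u (b : R) : L1 P u -> norm_rho rho u < b%:E ->
  (0 < b)%R /\ rho (abs_div u b) <= 1.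
Proof.
move=> Lu /ereal_inf_lt[_ [b' [b0 h] <-]]; rewrite lte_fin => bb.
split; first exact: lt_trans bb.
apply: le_trans h; apply: rho_abs_div_le => //; first exact: ltW.
exact: nearW.
Qed.

(** The infimum defining the norm is attained: if the norm is at most [b], then [|u| / (b * t)] has
    [rho] at most 1 for every [t > 1] and tends to [|u| / b] in L^1 as [t] decreases to 1, so lower
    semicontinuity applies. *)
Lemma norm_rho_leP u (b : R) : L1 P u -> (0 < b)%R ->
  norm_rho rho u <= b%:E <-> rho (abs_div u b) <= 1.
Proof.
move=> Lu b0; split=> [h|h]; last by apply: ereal_inf_lbound; exists b.
have Lb := L1_abs_div b Lu.
apply: rho_sublevel_closed => // r r0.
pose n := fine 'N[P]_1[EFin \o abs_div u b].
have nE := seminormedE (L1_seminormed P) Lb; rewrite -/n in nE.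
have n0 : (0 <= n)%R by rewrite fine_ge0// Lnorm_ge0.
(* The distance from [|u| / (b * t)] to [|u| / b] is [n * (1 - 1 / t) = n * (r / (n + 1)) / t < r];
   [n + 1] covers the case [n = 0]. *)
pose t := (1 + r / (n + 1))%R.
have t1 : (1 < t)%R by rewrite ltrDl divr_gt0// ltr_wpDl.
have t0 : (0 < t)%R by exact: lt_trans t1.
exists (abs_div u (b * t)); split; first exact: L1_abs_div.
- rewrite abs_div_scale (_ : _ - _ = (t^-1 - 1) *: abs_div u b)%R; last first.
    by rewrite scalerBl scale1r.
  rewrite (seminormedZ (L1_seminormed P))// nE -EFinM lte_fin ltr0_norm; last first.
    by rewrite subr_lt0 invf_lt1.
  have tE : (- (t^-1 - 1) = r / (n + 1) / t)%R.
    by rewrite -[(r / _)%R](addKr 1%R) -/t; field; exact: lt0r_neq0.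
  rewrite tE mulrAC ltr_pdivrMr// mulrAC ltr_pdivrMr ?ltr_wpDl//.
  rewrite -mulrA ltr_pM2l// (@lt_le_trans _ _ (n + 1)%R)//; first by rewrite ltrDl.
  by rewrite ler_peMl ?addr_ge0// ltW.
- have [] // := @norm_rho_lt u (b * t) Lu.
  by rewrite (le_lt_trans h)// lte_fin ltr_pMr.
Qed.

Lemma norm_rho_le1 u : L1 P u -> norm_rho rho u <= 1 <-> rho ((fun w => `|u w|%R)) <= 1.
Proof. by move=> Lu; rewrite -abs_div1; exact: norm_rho_leP. Qed.

Lemma norm_rho_ae_le u v : L1 P u -> L1 P v ->
  (\forall w \ae P, (`|u w| <= `|v w|)%R) -> norm_rho rho u <= norm_rho rho v.
Proof.
move=> Lu Lv uv; apply: le_ereal_inf_tmp => _ [b [b0 h] <-].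
apply: ereal_inf_lbound; exists b => //; split => //.
by apply: le_trans h; exact: rho_abs_div_le.
Qed.

Lemma norm_rho_le_cst u (k : R) : L1 P u -> (0 < k)%R ->
  (\forall w \ae P, (`|u w| <= k)%R) -> norm_rho rho u <= k%:E.
Proof.
move=> Lu k0 uk; apply/norm_rho_leP => //.
apply: rho_le_cst; first exact: L1_abs_div.
apply: filterS uk => w uk.
by rewrite ger0_norm ?(abs_div_ge0 _ _ (ltW k0))// /abs_div ler_pdivrMr// mul1r.
Qed.

(** By convexity between the argument and 0, dividing the argument by [a >= 1] divides the bound on
    [rho] by [a]. This converts values of [rho] above 1 into norm bounds. *)
Lemma norm_rho_le_max u (a : R) : L1 P u -> (1 <= a)%R ->
  rho ((fun w => `|u w|%R)) <= a%:E -> norm_rho rho u <= a%:E.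
Proof.
move=> Lu a1 h; have a0 : (0 < a)%R by exact: lt_le_trans a1.
apply/norm_rho_leP => //; rewrite -abs_div1 in h.
have := rho_abs_div_scale Lu ltr01 a1 h.
by rewrite mul1r divff// gt_eqF.
Qed.

Lemma Lrho_L1 u : Lrho P rho u -> L1 P u. Proof. by case. Qed.

Lemma Linf_Lrho u : Linf P u -> Lrho P rho u.
Proof.
move=> Lu; have [k k0 uk] := Linf_ae_bound Lu.
split; first exact: Linf_L1.
by apply: le_lt_trans (ltry k); apply: norm_rho_le_cst => //; exact: Linf_L1.
Qed.

Lemma norm_rho_le_Linf u : Linf P u -> norm_rho rho u <= 'N[P]_+oo[EFin \o u].
Proof.
move=> Lu; rewrite (seminormedE (Linf_seminormed P) Lu); set k := fine _.
have uk : \forall w \ae P, (`|u w| <= k)%R.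
  by apply/Linf_norm_le; rewrite (seminormedE (Linf_seminormed P) Lu).
apply/lee_addgt0Pr => e e0; rewrite -EFinD; apply: norm_rho_le_cst => //.
- exact: Linf_L1.
- by rewrite ltr_wpDl// fine_ge0// Lnorm_ge0.
- by apply: filterS uk => w /le_trans; apply; rewrite lerDl ltW.
Qed.

Lemma norm_rho0 : norm_rho rho 0%R = 0.
Proof.
apply/eqP; rewrite eq_le norm_rho_ge0 andbT; apply/lee_addgt0Pr => e e0.
rewrite add0e; apply: norm_rho_le_cst => //; first exact: s1.1.
by apply: nearW => w; rewrite normr0 ltW.
Qed.

Lemma norm_rho_seminormed : seminormed (Lrho P rho) (norm_rho rho).
Proof.
have Zle a u : Lrho P rho u -> norm_rho rho (a *: u)%R <= `|a|%:E * norm_rho rho u.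
  move=> [Lu Nu]; have [->|a0] := eqVneq a 0%R.
    by rewrite scale0r norm_rho0 normr0 mul0e.
  have na : (0 < `|a|)%R by rewrite normr_gt0.
  have Nfin : norm_rho rho u \is a fin_num by rewrite ge0_fin_numE ?norm_rho_ge0.
  rewrite -(fineK Nfin); set n := fine _.
  apply/lee_addgt0Pr => e e0; rewrite -EFinM -EFinD.
  pose b := (n + e / `|a|)%R.
  have [b0 hb] : (0 < b)%R /\ rho (abs_div u b) <= 1.
    by apply: norm_rho_lt => //; rewrite -(fineK Nfin) lte_fin ltrDl divr_gt0.
  rewrite (_ : _ + e = `|a| * b)%R; last by rewrite /b; field; rewrite gt_eqF.
  apply/norm_rho_leP; [exact: (subspaceZ s1)|exact: mulr_gt0|].
  rewrite (_ : abs_div _ _ = abs_div u b)//; apply/funext => w; rewrite /abs_div fctE.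
  by rewrite normrM -mulf_div divff ?mul1r// gt_eqF.
have ZL a u : Lrho P rho u -> Lrho P rho (a *: u)%R.
  move=> Lu; split; first exact/(subspaceZ s1)/Lrho_L1.
  by apply: le_lt_trans (Zle _ _ Lu) _; apply: lte_mul_pinfty => //; case: Lu.
have D u v : Lrho P rho u -> Lrho P rho v ->
    norm_rho rho (u + v)%R <= norm_rho rho u + norm_rho rho v.
  move=> [Lu Nu] [Lv Nv].
  have Nufin : norm_rho rho u \is a fin_num by rewrite ge0_fin_numE ?norm_rho_ge0.
  have Nvfin : norm_rho rho v \is a fin_num by rewrite ge0_fin_numE ?norm_rho_ge0.
  rewrite -(fineK Nufin) -(fineK Nvfin); set n := fine _; set m := fine _.
  apply/lee_addgt0Pr => e e0; rewrite -!EFinD.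
  pose b := (n + e / 2)%R; pose c := (m + e / 2)%R.
  have e2 : (0 < e / 2)%R by rewrite divr_gt0.
  have [b0 hb] : (0 < b)%R /\ rho (abs_div u b) <= 1.
    by apply: norm_rho_lt => //; rewrite -(fineK Nufin) lte_fin ltrDl.
  have [c0 hc] : (0 < c)%R /\ rho (abs_div v c) <= 1.
    by apply: norm_rho_lt => //; rewrite -(fineK Nvfin) lte_fin ltrDl.
  rewrite (_ : n + m + e = b + c)%R; last by rewrite /b /c; field.
  have bc0 : (0 < b + c)%R by exact: addr_gt0.
  apply/norm_rho_leP => //; first exact: (subspaceD s1).
  (* With this weight, [|u + v| / (b + c)] is at most the convex combination of [|u| / b] and
     [|v| / c], both of which have [rho] at most 1. *)
  pose t := (b / (b + c))%R.
  have tt : (0 < t < 1)%R by rewrite divr_gt0//= ltr_pdivrMr// mul1r ltrDl.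
  have := rho_convex (L1_abs_div b Lu) (L1_abs_div c Lv) hb hc tt.
  rewrite !mulr1 addrCA subrr addr0; apply: le_trans.
  apply: rho_nondecreasing.
  - by apply: L1_abs_div; exact: (subspaceD s1).
  - by apply: s1.2; [exact: L1_abs_div|apply: (subspaceZ s1); exact: L1_abs_div].
  apply: nearW => w; rewrite !fctE /abs_div ?fctE.
  rewrite ler_pdivrMr//.
  have -> : ((t *: (`|u w| / b) + (1 - t) *: (`|v w| / c)) * (b + c) = `|u w| + `|v w|)%R.
    rewrite /t -![_ *: _]/(_ * _)%R; field; rewrite ?gt_eqF//.
  exact: ler_normD.
split => //.
- split; first by apply: Linf_Lrho; exact: Linf_cst.
  move=> a u v Lu Lv; have [Lau Nau] := ZL a u Lu.
  split; first by apply: (subspaceD s1) => //; exact: Lrho_L1.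
  apply: le_lt_trans (D _ _ (ZL a u Lu) Lv) _; apply: lte_add_pinfty => //.
  by case: Lv.
- by move=> u _; exact: norm_rho_ge0.
- by move=> u [].
- move=> a u Lu; apply/eqP; rewrite eq_le Zle//=.
  have [->|a0] := eqVneq a 0%R; first by rewrite normr0 mul0e norm_rho_ge0.
  have na : (0 < `|a|)%R by rewrite normr_gt0.
  rewrite muleC -lee_pdivlMr// muleC -normfV.
  by have := Zle a^-1%R _ (ZL a u Lu); rewrite scalerA mulVf// scale1r.
Qed.

(** * Domination of the L^1 norm and completeness of L^rho *)

Section domination.
Variables (c : R) (c_gt0 : (0 < c)%R).
Hypothesis rho_L1 : forall u : T -> R, L1 P u ->
  rho (fun w => `|u w|%R) <= 1 -> 'N[P]_1[EFin \o u] <= c%:E.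

Lemma norm1_le_norm_rho u : Lrho P rho u ->
  'N[P]_1[EFin \o u] <= c%:E * norm_rho rho u.
Proof.
move=> Lu; have L1u := Lrho_L1 Lu.
rewrite (seminormedE norm_rho_seminormed Lu) -EFinM; set n := fine _.
have n0 : (0 <= n)%R by rewrite fine_ge0// norm_rho_ge0.
apply/lee_addgt0Pr => e e0; rewrite -EFinD.
pose b := (n + e / c)%R.
have [b0 hb] : (0 < b)%R /\ rho (abs_div u b) <= 1.
  apply: norm_rho_lt => //; rewrite (seminormedE norm_rho_seminormed Lu) -/n.
  by rewrite lte_fin ltrDl divr_gt0.
have := @rho_L1 (abs_div u b) (L1_abs_div b L1u).
rewrite (_ : (fun w => `|_|%R) = abs_div u b); last first.
  by apply/funext => w; rewrite ger0_norm// abs_div_ge0// ltW.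
move=> /(_ hb); rewrite abs_divE (seminormedZ (L1_seminormed P)); last exact: L1_norm.
have -> : 'N[P]_1[EFin \o (fun w => `|u w|%R)] = 'N[P]_1[EFin \o u].
  by rewrite -[RHS]Lnorm_abse.
rewrite (seminormedE (L1_seminormed P) L1u) -EFinM !lee_fin.
rewrite gtr0_norm ?invr_gt0// mulrC ler_pdivrMr// => /le_trans; apply.
by rewrite /b le_eqVlt; apply/orP; left; apply/eqP; field; rewrite gt_eqF.
Qed.

Lemma norm_rho_eq0 u : Lrho P rho u ->
  norm_rho rho u = 0 <-> (\forall w \ae P, u w = 0%R).
Proof.
move=> Lu; have L1u := Lrho_L1 Lu; split=> [N0|u0].
  have : 'N[P]_1[EFin \o u] = 0.
    apply/eqP; rewrite eq_le Lnorm_ge0 andbT.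
    by rewrite (le_trans (norm1_le_norm_rho Lu))// N0 mule0.
  move=> /Lnorm_eq0_eq0 h; have : ae_eq P setT (EFin \o u) (cst 0).
    by apply: h => //; exact/measurable_EFinP/(L1_measurable L1u).
  by apply: filterS => w /(_ I) [].
apply/eqP; rewrite eq_le norm_rho_ge0 andbT -norm_rho0.
apply: norm_rho_ae_le => //; first exact: s1.1.
by apply: filterS u0 => w ->.
Qed.

Hypothesis L1_complete : complete_on (L1 P) (fun u => 'N[P]_1[EFin \o u]).

Lemma complete_Lrho : complete_on (Lrho P rho) (norm_rho rho).
Proof.
move=> u_ Lu_ cu_; have L1u_ n : L1 P (u_ n) by exact: Lrho_L1.
have sN := norm_rho_seminormed.
have LB n k : Lrho P rho (u_ n - u_ k)%R by apply: (subspaceB (seminormed_subspace sN)).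
have [|u Lu ucvg] := L1_complete L1u_.
  move=> e e0; have [n0 hn0] := cu_ (e / c)%R (divr_gt0 e0 c_gt0).
  exists n0 => n k nn0 kn0; apply: le_lt_trans (norm1_le_norm_rho (LB n k)) _.
  have := hn0 n k nn0 kn0; rewrite (seminormedE sN (LB n k)) -EFinM !lte_fin.
  by rewrite ltr_pdivlMr// mulrC.
(* For fixed [n], the differences [u_ n - u_ k] stay in the ball of radius [e] and tend to
   [u_ n - u] in L^1 as [k] grows; the ball is closed in L^1 by [rho_sublevel_closed]. *)
have key e : (0 < e)%R -> exists n0 : nat, forall n, (n0 <= n)%N ->
    norm_rho rho (u_ n - u)%R <= e%:E.
  move=> e0; have [n0 hn0] := cu_ e e0; exists n0 => n nn0.
  have Lnu : L1 P (u_ n - u)%R by apply: (subspaceB s1).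
  apply/norm_rho_leP => //; apply: rho_sublevel_closed => [|r r0]; first exact: L1_abs_div.
  have er : (0 < e * r)%R by exact: mulr_gt0.
  have /fine_cvgP[_ /cvgrPdist_lt/(_ _ er)[n1 _ hn1]] := ucvg.
  pose k := maxn n0 n1; exists (abs_div (u_ n - u_ k)%R e); split.
  - by apply: L1_abs_div; exact: (subspaceB s1).
  - have Luk : L1 P (u_ k - u)%R by apply: (subspaceB s1).
    apply: (@le_lt_trans _ _ 'N[P]_1[EFin \o (e^-1 *: (u_ k - u))%R]).
      apply: le_Lnorm1.
      + apply/L1_measurable/(subspaceB s1); apply: L1_abs_div => //.
        exact: (subspaceB s1).
      + exact/L1_measurable/(subspaceZ s1).
      + apply: nearW => w; rewrite !fctE /abs_div ?fctE -mulrBl normrM [leRHS]normrM.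
        rewrite mulrC ler_wpM2l//; apply: le_trans (ler_dist_dist _ _) _.
        by rewrite (_ : _ - _ - _ = - (u_ k w - u w))%R ?normrN//; ring.
    rewrite (seminormedZ (L1_seminormed P))// (seminormedE (L1_seminormed P))//.
    rewrite -EFinM lte_fin gtr0_norm ?invr_gt0// mulrC ltr_pdivrMr// mulrC.
    have := hn1 k (leq_maxr _ _); rewrite /= sub0r normrN.
    exact/le_lt_trans/ler_norm.
  - have [] // := @norm_rho_lt (u_ n - u_ k)%R e; first exact: (subspaceB s1).
    by apply: hn0 => //; exact: leq_maxl.
have Lru : Lrho P rho u.
  have [n0 hn0] := key 1%R ltr01.
  rewrite -[u](subKr (u_ n0)); apply: (subspaceB (seminormed_subspace sN)) => //.
  split; first exact: (subspaceB s1).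
  exact: le_lt_trans (hn0 _ (leqnn _)) (ltry _).
exists u => //.
have LnB n : Lrho P rho (u_ n - u)%R by apply: (subspaceB (seminormed_subspace sN)).
apply/fine_cvgP; split.
  by apply: nearW => n; rewrite (seminormedE sN (LnB n)).
apply/cvgrPdist_le => e e0; have [n0 hn0] := key e e0.
exists n0 => // n /= nn0; rewrite sub0r normrN ger0_norm; last first.
  by rewrite fine_ge0// norm_rho_ge0.
by rewrite -lee_fin -(seminormedE sN (LnB n)); exact: hn0.
Qed.

Lemma banach_Lrho : banach_mod_ae P (Lrho P rho) (norm_rho rho).
Proof.
have sN := norm_rho_seminormed; split.
- split; [exact: (subspace0 (seminormed_subspace sN))|exact: (seminormed_subspace sN).2|].
  move=> u v [Lu Nu] mv uv.
  have vu : \forall w \ae P, (`|v w| <= `|u w|)%R by apply: filterS uv => w ->.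
  have Lv : L1 P v by exact: L1_ae_dominated Lu vu.
  by split => //; apply: le_lt_trans Nu; exact: norm_rho_ae_le.
- move=> u Lu; split; last exact: norm_rho_eq0.
  by rewrite norm_rho_ge0 (seminormed_lty sN).
- by move=> a u Lu; exact: (seminormedZ sN).
- by move=> u v Lu Lv; exact: (seminormedD sN).
- exact: complete_Lrho.
Qed.

End domination.
End risk_functional.

(** * The dual of L^rho *)

Section dual_of_Lrho.
Context {d : measure_display} {T : measurableType d} {R : realType}.
Variables (P : probability T R) (rho : (T -> R) -> \bar R).
Hypothesis rhoP : risk_functional P rho.
Implicit Types (u v xi : T -> R).
Let sL := subspace_Linf P.
Let s1 := subspace_L1 P.
Let sN := norm_rho_seminormed rhoP.
Let sLr := seminormed_subspace sN.

Lemma additive_charge_exists (mu : set T -> \bar R) :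
  (forall A, measurable A -> mu A \is a fin_num) -> mu set0 = 0 ->
  (forall A B, measurable A -> measurable B -> A `&` B = set0 ->
    mu (A `|` B) = mu A + mu B) ->
  exists m : {additive_charge set T -> \bar R}%R, forall A, m A = mu A.
Proof.
move=> fmu mu0 amu.
have smu : measure_function.semi_additive mu by apply/additive2P.
pose i1 := isFinite.Build d T R mu fmu.
pose i2 := isAdditiveCharge.Build d T R mu smu.
pose m : {additive_charge set T -> \bar R}%R := HB.pack mu i1 i2.
by exists m.
Qed.

Lemma rho_nneg_fin xi : Linf_nneg P xi -> rho xi \is a fin_num.
Proof.
move=> [Lxi xi0]; have L1xi := Linf_L1 Lxi.
rewrite ge0_fin_numE; last exact: (rho_ge0 rhoP).
have [k _ hk] := Linf_ae_bound Lxi.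
exact: le_lt_trans (rho_le_cst rhoP L1xi hk) (ltry _).
Qed.

Lemma Linf_nneg_abs u : Linf P u -> Linf_nneg P (fun w => `|u w|%R).
Proof. by move=> Lu; split; [exact: Linf_norm|apply: nearW => w; exact: normr_ge0]. Qed.

Lemma linear_onS (V D : set (T -> R)) (f : (T -> R) -> R) : D `<=` V ->
  linear_on V f -> linear_on D f.
Proof. by move=> DV lf a u v Du Dv; apply: lf; exact: DV. Qed.

Section additive_charge.
Variable m : {additive_charge set T -> \bar R}%R.
Hypothesis Mm : M1 P m.
Let F := int_Linf P m.
Let p := absfun P F.
Let pf xi := fine (p xi).

(** This is Young's inequality. At bounded nonnegative [xi] both [rho] and the integral against
    [|m|] are finite, so the condition on the conjugate reduces to inequalities between real
    numbers. *)
Lemma alpha_variation_div_le (b a : R) : (0 < b)%R ->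
  alpha P rho (variation_div m b) <= a%:E <->
  forall xi, Linf_nneg P xi -> (pf xi <= b * (a + fine (rho xi)))%R.
Proof.
move=> b0; have term xi : Linf_nneg P xi ->
    (int_Linf P (variation_div m b) xi)%:E - rho xi =
    (pf xi / b - fine (rho xi))%:E.
  move=> Lxi; rewrite (int_Linf_variation_div Mm b0 Lxi).
  by rewrite -[in LHS](fineK (rho_nneg_fin Lxi)).
split=> [h xi Lxi|h].
  have : (int_Linf P (variation_div m b) xi)%:E - rho xi <= a%:E.
    by apply: le_trans h; apply: ereal_sup_ubound; exists xi.
  by rewrite term// lee_fin lerBlDr ler_pdivrMr// mulrC.
apply: ge_ereal_sup => _ [xi Lxi <-]; rewrite term// lee_fin lerBlDr ler_pdivrMr//.
by rewrite mulrC h.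
Qed.

Lemma alpha_ge0 (b : R) : (0 < b)%R -> 0 <= alpha P rho (variation_div m b).
Proof.
move=> b0; apply: ereal_sup_ubound; exists (fun=> 0%R).
  by split; [exact: Linf_cst|exact: nearW].
have L0 : Linf_nneg P (fun=> 0%R) by split; [exact: Linf_cst|exact: nearW].
have [C [C0 _ lF bF]] := int_LinfP Mm.
rewrite (int_Linf_variation_div Mm b0 L0) (risk_0 rhoP) sube0.
have -> : rho_m P m (fun=> 0%R) = 0.
  exact: (seminormed0 (absfun_seminormed C0 lF bF)).
by rewrite mul0r.
Qed.

Lemma alpha_fin (b : R) : (0 < b)%R -> alpha P rho (variation_div m b) < +oo ->
  exists2 a : R, (0 <= a)%R & alpha P rho (variation_div m b) = a%:E.
Proof.
move=> b0 h; have fa : alpha P rho (variation_div m b) \is a fin_num.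
  by rewrite ge0_fin_numE// alpha_ge0.
exists (fine (alpha P rho (variation_div m b))); last by rewrite fineK.
by rewrite fine_ge0// alpha_ge0.
Qed.

(** Only bounded functions enter [alpha], but [rho_m] is itself a supremum over bounded [v] below
    [|u|]. For [g] just above the norm of [u], each [|v| / g] has [rho] at most 1, and Young's
    inequality applies to it. *)
Lemma rho_m_le_norm_rho (b a : R) u : (0 < b)%R -> (0 <= a)%R ->
  alpha P rho (variation_div m b) <= a%:E -> Lrho P rho u ->
  p u <= (b * (a + 1))%:E * norm_rho rho u.
Proof.
move=> b0 a0 /(alpha_variation_div_le _ b0) h Lu; have Lu1 := Lrho_L1 Lu.
have [C [C0 _ lF bF]] := int_LinfP Mm.
rewrite (seminormedE sN Lu) -EFinM; set n := fine _.
have n0 : (0 <= n)%R by rewrite fine_ge0// norm_rho_ge0.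
have q0 : (0 < b * (a + 1))%R by rewrite mulr_gt0// ltr_wpDl.
apply: ge_ereal_sup => _ [v [Lv vu] <-]; rewrite lee_fin.
(* The slack makes [g] exceed the norm strictly, also when the norm is zero, and becomes exactly [e]
   after multiplication by [b * (a + 1)]. *)
apply/ler_addgt0Pr => e e0; pose g := (n + e / (b * (a + 1)))%R.
have [g0 hg] : (0 < g)%R /\ rho (abs_div u g) <= 1.
  apply: (norm_rho_lt rhoP Lu1).
  by rewrite (seminormedE sN Lu) lte_fin ltrDl divr_gt0.
have Ldv := Linf_abs_div g Lv.
have nnv : Linf_nneg P (abs_div v g).
  by split => //; apply: nearW => w; rewrite abs_div_ge0// ltW.
have rv : (fine (rho (abs_div v g)) <= 1)%R.
  rewrite -lee_fin fineK ?rho_nneg_fin// (le_trans _ hg)//.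
  apply: (rho_abs_div_le rhoP) => //; exact: Linf_L1.
have -> : (b * (a + 1) * n + e = b * (a + 1) * g)%R.
  by rewrite /g; field; rewrite !gt_eqF// ltr_wpDl.
have Fv : ((F v)%:E <= p v).
  by apply: le_trans (absfun_self lF Lv); rewrite lee_fin ler_norm.
have pv : p v = g%:E * p (abs_div v g).
  rewrite /p abs_divE (absfunZ C0 lF bF) muleA -EFinM gtr0_norm ?invr_gt0//.
  by rewrite mulfV ?gt_eqF// mul1e absfun_norm.
have pfin : p (abs_div v g) \is a fin_num by exact: (absfun_Linf_fin C0 lF bF Ldv).
rewrite -lee_fin (le_trans Fv)// pv -(fineK pfin) -EFinM lee_fin mulrC ler_pM2r//.
by rewrite (le_trans (h _ nnv))// ler_pM2l// lerD2l.
Qed.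

Hypothesis alpha_lty : exists2 b : R, (0 < b)%R & alpha P rho (variation_div m b) < +oo.

Lemma rho_m_norm_rho : exists2 K : R, (0 < K)%R &
  forall u, Lrho P rho u -> p u <= K%:E * norm_rho rho u.
Proof.
have [b b0 hb] := alpha_lty; have [a a0 ha] := alpha_fin b0 hb.
exists (b * (a + 1))%R; first by rewrite mulr_gt0// ltr_wpDl.
by move=> u; apply: rho_m_le_norm_rho => //; rewrite ha.
Qed.

Lemma Lrho_dom_rho_m : Lrho P rho `<=` dom P p.
Proof.
move=> u Lu; split; first exact: Lrho_L1 Lu.
have [K K0 h] := rho_m_norm_rho; apply: le_lt_trans (h u Lu) _.
by rewrite (seminormedE sN Lu) -EFinM ltry.
Qed.

Lemma int_domP : [/\ forall u, Linf P u -> int_dom P m u = int_Linf P m u,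
  linear_on (Lrho P rho) (int_dom P m),
  forall u, Lrho P rho u -> `|int_dom P m u|%:E <= p u &
  exists2 K, (0 < K)%R & bounded_on (Lrho P rho) (norm_rho rho) K (int_dom P m)].
Proof.
have [C [C0 _ lF bF]] := int_LinfP Mm.
have [h1 h2 h3] := cont_linear_ext_absfunP C0 lF bF.
have h4 u : Lrho P rho u -> `|int_dom P m u|%:E <= p u.
  by move=> /Lrho_dom_rho_m; exact: h3.
split=> //; first exact: linear_onS Lrho_dom_rho_m h2.
have [K K0 h] := rho_m_norm_rho.
by exists K => // u Lu; apply: le_trans (h4 u Lu) (h u Lu).
Qed.

(** Unbounded [u] contribute nothing new: [|int_dom P m u|] is at most [rho_m u], a supremum over
    bounded [v] with [|v| <= |u|], and these satisfy the constraint by monotonicity. *)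
Lemma dual_norm_rhoE : dual_norm_rho P rho m =
  ereal_sup [set (int_Linf P m u)%:E |
    u in [set u | Linf P u /\ rho (fun w => `|u w|%R) <= 1]].
Proof.
have [h1 h2 h3 _] := int_domP.
apply/eqP; rewrite eq_le; apply/andP; split.
  apply: ge_ereal_sup => _ [u [Lu Nu] <-]; rewrite (le_trans (h3 u Lu))//.
  apply: ge_ereal_sup => _ [v [Lv vu] <-]; apply: ereal_sup_ubound.
  exists v => //; split => //.
  have /(norm_rho_le1 rhoP (Lrho_L1 Lu)) : norm_rho rho u <= 1 by [].
  apply: le_trans; apply: (risk_nondecreasing rhoP) => //.
  - exact/L1_norm/Linf_L1.
  - exact/L1_norm/(Lrho_L1 Lu).
apply: ge_ereal_sup => _ [u [Lu ru] <-].
apply: (@le_trans _ _ `|int_dom P m u|%:E); first by rewrite h1// lee_fin ler_norm.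
apply: ereal_sup_ubound; exists u => //; split; first exact: Linf_Lrho.
by apply/(norm_rho_le1 rhoP) => //; exact: Linf_L1.
Qed.

Lemma dual_norm_rho_le (b a : R) : (0 < b)%R ->
  alpha P rho (variation_div m b) <= a%:E ->
  dual_norm_rho P rho m <= (b * (a + 1))%:E.
Proof.
move=> b0 /(alpha_variation_div_le _ b0) h; rewrite dual_norm_rhoE.
have [C [C0 _ lF bF]] := int_LinfP Mm.
apply: ge_ereal_sup => _ [u [Lu ru] <-].
have nnu := Linf_nneg_abs Lu.
apply: (@le_trans _ _ (p u)).
  by apply: le_trans (absfun_self lF Lu); rewrite lee_fin ler_norm.
rewrite /p -(absfun_norm P F u) -(fineK (absfun_Linf_fin C0 lF bF nnu.1)) lee_fin.
rewrite (le_trans (h _ nnu))// ler_pM2l// lerD2l.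
by rewrite -lee_fin fineK ?rho_nneg_fin.
Qed.

Lemma dual_norm_rho_fin : exists2 s : R, (0 <= s)%R & dual_norm_rho P rho m = s%:E.
Proof.
have [b b0 hb] := alpha_lty; have [a a0 ha] := alpha_fin b0 hb.
have ge0 : 0 <= dual_norm_rho P rho m.
  apply: le_ereal_sup_tmp; exists `|int_dom P m 0%R|%:E; last by rewrite lee_fin.
  exists 0%R => //; split; first exact: subspace0 sLr.
  by rewrite (norm_rho0 rhoP).
have fin : dual_norm_rho P rho m \is a fin_num.
  rewrite ge0_fin_numE//; apply: le_lt_trans (ltry (b * (a + 1))%R).
  by apply: dual_norm_rho_le => //; rewrite ha.
by exists (fine (dual_norm_rho P rho m)); [rewrite fine_ge0|rewrite fineK].
Qed.

(* Lagrangian duality for [sup {pf xi | rho xi <= 1}]: [beta] is the multiplier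
   of the constraint, i.e. a supergradient of the value function at 1. *)
Lemma dual_norm_rho_multiplier (s : R) : dual_norm_rho P rho m = s%:E -> (0 <= s)%R ->
  exists2 beta : R, (0 <= beta)%R & forall xi, Linf_nneg P xi ->
    (pf xi <= s + beta * (fine (rho xi) - 1))%R.
Proof.
move=> sE s0; have [C [C0 _ lF bF]] := int_LinfP Mm.
pose r xi := fine (rho xi).
have rE xi : Linf_nneg P xi -> rho xi = (r xi)%:E by move=> Lx; rewrite fineK// rho_nneg_fin.
have pfE xi : Linf_nneg P xi -> p xi = (pf xi)%:E.
  by move=> Lx; rewrite fineK// (absfun_Linf_fin C0 lF bF Lx.1).
have h1 xi : Linf_nneg P xi -> (r xi <= 1)%R -> (pf xi <= s)%R.
  move=> Lx rx; rewrite -lee_fin -pfE// -sE dual_norm_rhoE.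
  apply: ge_ereal_sup => _ [v [Lv vx] <-]; apply: ereal_sup_ubound.
  exists v => //; split => //; apply: (@le_trans _ _ (rho xi)); last by rewrite rE.
  apply: (risk_nondecreasing rhoP).
  - exact/L1_norm/Linf_L1.
  - exact/Linf_L1/Lx.1.
  - by apply: filterS2 vx Lx.2 => w + x0; rewrite (ger0_norm x0).
(* The weight [t] solves [t * r xi + (1 - t) * r eta = 1], so the combination is feasible; [pf] is
   affine along it, which puts every slope to the right of 1 below every slope to the left. *)
have slope xi eta : Linf_nneg P xi -> Linf_nneg P eta ->
    (r xi < 1)%R -> (1 < r eta)%R ->
    ((pf eta - s) * (1 - r xi) <= (s - pf xi) * (r eta - 1))%R.
  move=> Lx Le rx re.
  pose t := ((r eta - 1) / (r eta - r xi))%R.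
  have q0 : (0 < r eta - r xi)%R by lra.
  have tt : (0 < t < 1)%R.
    by apply/andP; split; [rewrite divr_gt0//; lra|rewrite /t ltr_pdivrMr// mul1r; lra].
  have tl : (1 - t = (1 - r xi) / (r eta - r xi))%R by rewrite /t; field; rewrite gt_eqF.
  case/andP: (tt) => t0 t1.
  have Lz : Linf_nneg P (t *: xi + (1 - t) *: eta)%R.
    split; first by apply: sL.2; [exact: Lx.1|apply: (subspaceZ sL); exact: Le.1].
    apply: filterS2 Lx.2 Le.2 => w x0 e0; rewrite !fctE.
    by rewrite addr_ge0// mulr_ge0// ?subr_ge0 ltW.
  have lz : pf (t *: xi + (1 - t) *: eta)%R = (t * pf xi + (1 - t) * pf eta)%R.
    rewrite /pf /p -!(absfun_lin_nneg C0 lF bF)//.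
    rewrite (absfun_lin_linear C0 lF bF)//; [|exact: Lx.1|exact/(subspaceZ sL)/Le.1].
    by rewrite (linear_onZ sL (absfun_lin_linear C0 lF bF))//; exact: Le.1.
  have : (pf (t *: xi + (1 - t) *: eta) <= s)%R.
    apply: h1 => //; rewrite -lee_fin -rE//.
    have := risk_convex rhoP (Linf_L1 Lx.1) (Linf_L1 Le.1) _ _ tt (a := r xi) (b := r eta).
    rewrite !rE// !lexx => /(_ isT isT); rewrite -rE// => /le_trans; apply.
    by rewrite lee_fin tl /t le_eqVlt; apply/orP; left; apply/eqP; field; rewrite gt_eqF.
  rewrite lz tl /t !(mulrAC _ (_^-1)%R) -mulrDl ler_pdivrMr// => h; nra.
(* Slopes to the right of 1. The constant 2 shows that there are some, and the constant 0, the
   Slater point, bounds them from above. *)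
pose A := [set ((pf eta - s) / (r eta - 1))%R | eta in
  [set eta | Linf_nneg P eta /\ (1 < r eta)%R]].
have L0 (k : R) : (0 <= k)%R -> Linf_nneg P (fun=> k).
  by move=> k0; split; [exact: Linf_cst|exact: nearW].
have r0 (k : R) : r (fun=> k) = k by rewrite /r (rho_cst rhoP).
have Aub xi : Linf_nneg P xi -> (r xi < 1)%R -> ubound A ((s - pf xi) / (1 - r xi))%R.
  move=> Lx rx _ [eta [Le re] <-].
  rewrite ler_pdivrMr ?subr_gt0// mulrAC ler_pdivlMr ?subr_gt0//.
  exact: slope.
have hsA : has_sup A.
  split; first by eexists; exists (fun=> 2%R) => //; split; [exact: L0|rewrite r0 ltr1n].
  by eexists; apply: (Aub (fun=> 0%R)); [exact: L0|rewrite r0].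
(* The maximum with 0 makes the multiplier nonnegative and remains below the slopes to the left of
   1, which are nonnegative because [pf xi <= s] at feasible [xi]. *)
exists (Num.max 0 (sup A))%R; first by rewrite le_max lexx.
move=> xi Lx; rewrite -/(r xi); set beta := Num.max _ _.
have beta0 : (0 <= beta)%R by rewrite /beta le_max lexx.
have [rx|rx|rx] := ltgtP (r xi) 1%R; last by rewrite rx subrr mulr0 addr0 h1// rx.
- have : (beta <= (s - pf xi) / (1 - r xi))%R.
    rewrite /beta ge_max divr_ge0 ?subr_ge0 ?h1 ?(ltW rx)//=.
    by apply: ge_sup; [exact: hsA.1|exact: Aub].
  rewrite ler_pdivlMr ?subr_gt0//; lra.
- have : ((pf xi - s) / (r xi - 1) <= beta)%R.
    rewrite /beta le_max; apply/orP; right; apply: ub_le_sup; first exact: hsA.2.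
    by exists xi.
  rewrite ler_pdivrMr ?subr_gt0//; lra.
Qed.

Lemma dual_norm_rho_inf : dual_norm_rho P rho m =
  ereal_inf [set b%:E * alpha P rho (variation_div m b) + b%:E | b in [set b : R | (0 < b)%R]].
Proof.
apply/eqP; rewrite eq_le; apply/andP; split.
  apply: le_ereal_inf_tmp => _ [b b0 <-].
  have [->|afin] := eqVneq (alpha P rho (variation_div m b)) +oo.
    by rewrite gt0_muley ?lte_fin// addye// leey.
  have [|a a0 aE] := alpha_fin b0; first by rewrite lt_neqAle afin leey.
  rewrite aE -EFinM -EFinD (_ : b * a + b = b * (a + 1))%R; last by ring.
  by apply: dual_norm_rho_le => //; rewrite aE.
have [s s0 sE] := dual_norm_rho_fin.
have [beta beta0 hbeta] := dual_norm_rho_multiplier sE s0.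
rewrite sE; apply/lee_addgt0Pr => e e0.
(* [beta] may vanish while [b] must be positive. The multiplier inequality gives
   [alpha(|m| / b) <= (s - beta) / b], so that [b * alpha(|m| / b) + b] is at most [s + e]. *)
pose b := (beta + e)%R; have b0 : (0 < b)%R by rewrite ltr_wpDl.
have ab : alpha P rho (variation_div m b) <= ((s - beta) / b)%:E.
  apply/(alpha_variation_div_le _ b0) => xi Lx.
  have rx : (0 <= fine (rho xi))%R.
    by apply: fine_ge0; apply: (rho_ge0 rhoP); [exact/Linf_L1/Lx.1|exact: Lx.2].
  have bK : (b * ((s - beta) / b) = s - beta)%R by rewrite mulrC divfK// gt_eqF.
  rewrite (le_trans (hbeta _ Lx))// [leRHS]mulrDr bK /b.
  have : (0 <= e * fine (rho xi))%R by rewrite mulr_ge0// ltW.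
  lra.
have [|a a0 aE] := alpha_fin b0; first exact: le_lt_trans ab (ltry _).
apply: (@le_trans _ _ (b%:E * alpha P rho (variation_div m b) + b%:E)).
  by apply: ereal_inf_lbound; exists b.
rewrite aE -EFinM -!EFinD lee_fin; move: ab; rewrite aE lee_fin ler_pdivlMr// mulrC /b.
lra.
Qed.

Lemma norm_alpha_le : norm_alpha P rho m <= dual_norm_rho P rho m.
Proof.
rewrite dual_norm_rho_inf; apply: le_ereal_inf_tmp => _ [b b0 <-].
have [->|afin] := eqVneq (alpha P rho (variation_div m b)) +oo.
  by rewrite gt0_muley ?lte_fin// addye// leey.
have [|a a0 aE] := alpha_fin b0; first by rewrite lt_neqAle afin leey.
(* Dividing by [b * (a + 1)] brings the conjugate to at most 1, because [a + r <= (a + 1) * (1 + r)]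
   for [r = rho xi >= 0]. *)
have t0 : (0 < b * (a + 1))%R by rewrite mulr_gt0// ltr_wpDl.
rewrite aE -EFinM -EFinD (_ : b * a + b = b * (a + 1))%R; last by ring.
apply: ereal_inf_lbound; exists (b * (a + 1))%R => //; split => //.
apply/(alpha_variation_div_le _ t0) => xi Lx.
have rx : (0 <= fine (rho xi))%R.
  by apply: fine_ge0; apply: (rho_ge0 rhoP); [exact/Linf_L1/Lx.1|exact: Lx.2].
have /(alpha_variation_div_le _ b0) h : alpha P rho (variation_div m b) <= a%:E by rewrite aE.
rewrite (le_trans (h _ Lx))// -mulrA ler_pM2l//.
have : (0 <= a * fine (rho xi))%R by rewrite mulr_ge0.
by rewrite mulrDl mulrDr; lra.
Qed.

(** The factor 2 is [a + 1] in [dual_norm_rho_le], at the level [a = 1] that defines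
    [norm_alpha]. *)
Lemma dual_norm_le_norm_alpha : dual_norm_rho P rho m <= 2%:E * norm_alpha P rho m.
Proof.
rewrite muleC -lee_pdivrMr//; apply: le_ereal_inf_tmp => _ [b [b0 hb] <-].
by rewrite lee_pdivrMr// -EFinM (le_trans (dual_norm_rho_le b0 hb)).
Qed.

End additive_charge.

Lemma charge_of_functional (F : (T -> R) -> R) (C : R) : (0 <= C)%R ->
  linear_on (Linf P) F -> bounded_on (Linf P) (fun u => 'N[P]_+oo[EFin \o u]) C F ->
  exists m : {additive_charge set T -> \bar R}%R,
    [/\ M1 P m, forall A, m A = (F \1_A)%:E &
        forall u, Linf P u -> int_Linf P m u = F u].
Proof.
move=> C0 lF bF.
have [||A B mA mB AB|m mE] := @additive_charge_exists (fun A => (F \1_A)%:E) => //.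
- by rewrite indic0 (linear_on0 sL lF).
- rewrite -EFinD -(linear_onD lF); [|exact: Linf_indic|exact: Linf_indic].
  congr (F _)%:E; apply/funext => w; rewrite !fctE !indicE in_setU.
  have [/set_mem wA|_] := boolP (w \in A); last by rewrite add0r.
  rewrite memNset ?addr0// => wB.
  by have : (A `&` B) w by []; rewrite AB.
exists m; split => //; last exact: (int_Linf_continuous_indic lF bF).
split.
  apply/null_content_dominatesP => A mA PA; rewrite mE; congr EFin.
  rewrite -(linear_on0 sL lF); apply: (Linf_functional_ae C0 lF bF).
  - exact: Linf_indic.
  - exact: subspace0 sL.
  - exists A; split => // w /= wA; apply: contrapT => nA; apply: wA.
    by rewrite indicE memNset.
exists (C * 1)%R => A mA; rewrite mE lee_fin.
apply: (Linf_functional_le C0 bF); first exact: Linf_indic.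
by apply: nearW => w; rewrite indicE; case: (_ \in _); rewrite ?normr1 ?normr0.
Qed.

Lemma bounded_on_Linf (F : (T -> R) -> R) (K : R) : (0 <= K)%R ->
  (forall u, Linf P u -> `|F u|%:E <= K%:E * norm_rho rho u) ->
  bounded_on (Linf P) (fun u => 'N[P]_+oo[EFin \o u]) K F.
Proof.
move=> K0 bF u Lu; apply: le_trans (bF u Lu) _; apply: lee_wpmul2l => //.
exact: (norm_rho_le_Linf rhoP).
Qed.

Lemma dual_Lrho_sum (m : {additive_charge set T -> \bar R}%R) z :
  Mrho P rho m -> annihilator_Linf P rho z ->
  dual_space (Lrho P rho) (norm_rho rho) (fun u => int_dom P m u + z u)%R.
Proof.
move=> [Mm am] [[lz cz] _]; have [_ lm _ [K K0 bm]] := int_domP Mm am.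
have [K' K'0 bz] := continuous_bounded sN lz cz.
have l : linear_on (Lrho P rho) (fun u => int_dom P m u + z u)%R.
  by move=> a u v Lu Lv; rewrite lm// lz//; ring.
split=> //; apply: (bounded_continuous sN (K := (K + K')%R) l) => u Lu.
have := bm u Lu; have := bz u Lu; rewrite (seminormedE sN Lu) -!EFinM !lee_fin.
by move=> h1 h2; rewrite (le_trans (ler_normD _ _))// mulrDl lerD.
Qed.

(** For bounded [v] with [|v| <= xi], [norm_rho_le_max] bounds the norm of [v] by [1 + rho xi]. The
    integral of [xi] against [|m|] is then at most [K * (1 + rho xi)], so the conjugate at [|m| / K]
    is at most 1. *)
Lemma Mrho_of_bounded (m : {additive_charge set T -> \bar R}%R) (K : R) :
  M1 P m -> (0 < K)%R ->
  (forall u, Linf P u -> `|int_Linf P m u|%:E <= K%:E * norm_rho rho u) ->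
  Mrho P rho m.
Proof.
move=> Mm K0 bm; split => //; exists K => //.
apply: (@le_lt_trans _ _ 1%:E); last exact: ltry.
apply/(alpha_variation_div_le Mm _ K0) => xi Lx.
have [C [C0 _ lF bF]] := int_LinfP Mm.
have rx : (0 <= fine (rho xi))%R.
  by apply: fine_ge0; apply: (rho_ge0 rhoP); [exact/Linf_L1/Lx.1|exact: Lx.2].
have L1x := Linf_L1 Lx.1.
rewrite -lee_fin fineK ?(absfun_Linf_fin C0 lF bF Lx.1)//.
apply: ge_ereal_sup => _ [v [Lv vx] <-].
apply: (@le_trans _ _ `|int_Linf P m v|%:E); first by rewrite lee_fin ler_norm.
rewrite (le_trans (bm v Lv))// EFinM; apply: lee_wpmul2l; first by rewrite lee_fin ltW.
apply: (norm_rho_le_max rhoP); [exact: Linf_L1|by rewrite lerDl|].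
apply: (@le_trans _ _ (rho xi)).
  apply: (risk_nondecreasing rhoP) => //; first exact/L1_norm/Linf_L1.
  by apply: filterS2 vx Lx.2 => w + x0; rewrite (ger0_norm x0).
by rewrite -(fineK (rho_nneg_fin Lx)) lee_fin lerDr.
Qed.

Lemma int_Linf_eq (m m' : {additive_charge set T -> \bar R}%R) :
  M1 P m -> M1 P m' -> (forall A, measurable A -> m A = m' A) ->
  forall u, Linf P u -> int_Linf P m u = int_Linf P m' u.
Proof.
move=> Mm Mm' mm'; have [C [C0 _ lF bF]] := int_LinfP Mm'.
apply: (int_Linf_continuous_indic lF bF) => A mA.
by rewrite mm'// int_Linf_indic// fineK// additive_charge_fin_num.
Qed.

(** [int_dom] is a choice of extension that depends on all of [m], including its values off the
    measurable sets. Since [rho_m] is the same for both measures, uniqueness of the extension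
    settles the matter. *)
Lemma int_dom_eq (m m' : {additive_charge set T -> \bar R}%R) :
  Mrho P rho m -> Mrho P rho m' -> (forall A, measurable A -> m A = m' A) ->
  forall u, Lrho P rho u -> int_dom P m u = int_dom P m' u.
Proof.
move=> [Mm am] [Mm' am'] mm' u Lu.
have eI := int_Linf_eq Mm Mm' mm'.
have eR : rho_m P m = rho_m P m'.
  apply/funext => v; congr ereal_sup; apply/seteqP.
  by split=> _ [w [Lw wv] <-]; exists w => //; rewrite eI.
have [C [C0 _ lF bF]] := int_LinfP Mm; have [C' [C0' _ lF' bF']] := int_LinfP Mm'.
have [h1 h2 h3] := cont_linear_ext_absfunP C0' lF' bF'.
have sp := absfun_seminormed C0' lF' bF'.
rewrite /int_dom eR; apply: (cont_linear_ext_unique sp).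
- exact: (Linf_dom_absfun C0' bF').
- exact: (dense_Linf_absfun lF').
- exact: h2.
- apply: (bounded_continuous sp (K := 1%R) h2) => v Lv.
  by rewrite mul1e; exact: h3.
- by move=> v Lv; rewrite eI//; exact: h1.
- exact: (Lrho_dom_rho_m Mm' am' Lu).
Qed.

Lemma dual_Lrho_decomposition phi :
  dual_space (Lrho P rho) (norm_rho rho) phi ->
  exists (m : {additive_charge set T -> \bar R}%R) (z : (T -> R) -> R),
    [/\ Mrho P rho m, annihilator_Linf P rho z,
        forall u, Lrho P rho u -> phi u = (int_dom P m u + z u)%R &
        forall m' z', Mrho P rho m' -> annihilator_Linf P rho z' ->
          (forall u, Lrho P rho u -> phi u = (int_dom P m' u + z' u)%R) ->
          (forall A, measurable A -> m' A = m A) /\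
          (forall u, Lrho P rho u -> z' u = z u)].
Proof.
move=> [lp cp]; have [K K0 bp] := continuous_bounded sN lp cp.
have LinfLr : Linf P `<=` Lrho P rho by move=> u; exact: Linf_Lrho.
have bpL : forall u, Linf P u -> `|phi u|%:E <= K%:E * norm_rho rho u.
  by move=> u /LinfLr; exact: bp.
have lpL := linear_onS LinfLr lp.
have [m [Mm mE mI]] := charge_of_functional (ltW K0) lpL (bounded_on_Linf (ltW K0) bpL).
have Rm : Mrho P rho m.
  by apply: (Mrho_of_bounded Mm K0) => u Lu; rewrite mI//; exact: bpL.
have [h1 h2 h3 [K' K'0 h4]] := int_domP Mm Rm.2.
pose z u := (phi u - int_dom P m u)%R.
exists m, z; split => //.
- split; last by move=> u Lu; rewrite /z h1// mI// subrr.
  have lz : linear_on (Lrho P rho) z by move=> a u v Lu Lv; rewrite /z lp// h2//; ring.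
  split=> //; apply: (bounded_continuous sN (K := (K + K')%R) lz) => u Lu.
  have := bp u Lu; have := h4 u Lu; rewrite (seminormedE sN Lu) -!EFinM !lee_fin.
  by move=> k1 k2; rewrite (le_trans (ler_normB _ _))// mulrDl lerD.
- by move=> u _; rewrite /z addrC subrK.
move=> m' z' Rm' Az' hphi.
have [h1' _ _ _] := int_domP Rm'.1 Rm'.2.
(* Annihilator terms vanish on indicators, so [phi] alone determines the measure of every set. *)
have mm' A : measurable A -> m' A = m A.
  move=> mA; have LA := Linf_indic P mA.
  rewrite mE hphi; last exact: LinfLr.
  rewrite Az'.2// addr0 h1'// (int_Linf_indic Rm'.1 mA) fineK//.
  exact: additive_charge_fin_num.
split=> // u Lu.
by rewrite /z hphi// (int_dom_eq Rm' Rm mm' Lu) addrC addKr.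
Qed.

End dual_of_Lrho.

(** * The closure of L^oo *)

Section truncation.
Context {d : measure_display} {T : measurableType d} {R : realType}.
Variable P : probability T R.
Implicit Types (u v y : T -> R).

Definition truncation u (n : nat) : T -> R := fun w => clip (u w) n%:R.

Lemma measurable_truncation u n :
  measurable_fun setT u -> measurable_fun setT (truncation u n).
Proof. by move=> mu; exact: measurable_clip. Qed.

Lemma normr_truncation u n w : `|truncation u n w|%R = Num.min `|u w|%R n%:R.
Proof. by rewrite normr_clip (ger0_norm (ler0n _ n)). Qed.

Lemma normrB_truncation u n w :
  `|u w - truncation u n w|%R = (`|u w| - Num.min `|u w| n%:R)%R.
Proof. by rewrite normrB_clip (ger0_norm (ler0n _ n)). Qed.

Lemma Linf_truncation u n : measurable_fun setT u -> Linf P (truncation u n).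
Proof.
move=> mu; apply: (@Linf_bounded _ _ _ _ _ n%:R); first exact: measurable_truncation.
by move=> w; rewrite normr_truncation ge_min lexx orbT.
Qed.

Lemma near_min_natr (x : R) : \forall n \near \oo, Num.min x n%:R = x.
Proof.
have [n _ hn] := nbhs_infty_ger x.
by exists n => // k /= /hn xk; apply/min_idPl.
Qed.

(** The conjugate tests bounded functions only; monotone convergence along truncations, which at
    each point are eventually equal to [u], carries their bounds to unbounded [u]. *)
Lemma integral_truncation_le u y (M : \bar R) :
  measurable_fun setT u -> measurable_fun setT y ->
  (forall n, \int[P]_w (`|truncation u n w| * `|y w|)%:E <= M) ->
  \int[P]_w (`|u w| * `|y w|)%:E <= M.
Proof.
move=> mu my hM; pose g n w := (`|truncation u n w| * `|y w|)%:E.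
have mg n : measurable_fun setT (g n).
  apply/measurable_EFinP; apply: measurable_funM; apply: measurableT_comp => //.
  exact: measurable_truncation.
have g0 n w : setT w -> 0 <= g n w by move=> _; rewrite lee_fin mulr_ge0.
have ndg w : setT w -> nondecreasing_seq (g ^~ w).
  move=> _ n k nk; rewrite lee_fin ler_wpM2r// !normr_truncation.
  by rewrite le_min ge_min lexx/= ge_min ler_nat nk orbT.
have gl w : limn (g ^~ w) = (`|u w| * `|y w|)%:E.
  apply: lim_near_cst => //; near=> n; rewrite /g normr_truncation.
  by congr (_ * _)%:E; near: n; exact: near_min_natr.
have c := @cvg_monotone_convergence _ _ _ P _ measurableT g mg g0 ndg.
rewrite (_ : (fun w => limn (g ^~ w)) = fun w => (`|u w| * `|y w|)%:E) in c; last exact/funext.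
rewrite -(cvg_lim _ c)//; apply: lime_le; first exact: cvgP c.
exact: nearW.
Unshelve. all: by end_near. Qed.

Lemma cvge0_near_le1 (f : nat -> \bar R) : f n @[n --> \oo] --> 0 ->
  exists n0, forall n, (n0 <= n)%N -> f n <= 1.
Proof.
move=> /fine_cvgP[[n1 _ h1]] /cvgrPdist_lt/(_ _ ltr01)[n2 _ h2].
exists (maxn n1 n2) => n; rewrite geq_max => /andP[n1n n2n].
rewrite -(fineK (h1 n n1n)) lee_fin; have := h2 n n2n.
by rewrite /= sub0r normrN => /ltW; apply: le_trans; exact: ler_norm.
Qed.

Lemma L1_mul_Linf u y : Linf P u -> L1 P y -> L1 P (u \* y)%R.
Proof.
move=> Lu Ly; have [k k0 uk] := Linf_ae_bound Lu.
apply: (@L1_ae_dominated _ _ _ _ _ (k *: y)%R).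
- by apply: measurable_funM; [exact: Linf_measurable Lu|exact: L1_measurable Ly].
- exact: subspaceZ (subspace_L1 P) _ _ Ly.
- apply: filterS uk => w uk; rewrite !fctE !normrM ler_wpM2r//.
  by rewrite (le_trans uk)// ler_norm.
Qed.

Lemma expectation_indicM A y : measurable A ->
  'E_P[(\1_A \* y)%R] = \int[P]_(w in A) (y w)%:E.
Proof.
move=> mA; rewrite unlock [RHS]integral_mkcond; apply: eq_integral => w _.
rewrite /patch /= indicE; case: (boolP (w \in A)) => wA.
  by rewrite mul1r.
by rewrite mul0r.
Qed.

Lemma expectation_linear (V : set (T -> R)) y :
  (forall u, V u -> L1 P (u \* y)%R) -> linear_on V (fun u => fine 'E_P[(u \* y)%R]).
Proof.
move=> VL a u v Vu Vv.
have iu := (L1_integrable P _).1 (VL u Vu); have iv := (L1_integrable P _).1 (VL v Vv).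
rewrite unlock.
have -> : \int[P]_w (((a *: u + v) \* y)%R w)%:E =
    \int[P]_w (a%:E * ((u \* y)%R w)%:E + ((v \* y)%R w)%:E).
  apply: eq_integral => w _; rewrite -EFinM -EFinD; congr EFin.
  by rewrite /= !fctE mulrDl -[a *: u w]/(a * u w)%R mulrA.
have iau : P.-integrable setT (fun w => a%:E * ((u \* y)%R w)%:E) by exact: integrableZl.
rewrite integralD// integralZl// fineD//.
- by rewrite fineM// ?integrable_fin_num.
- by rewrite fin_numM// integrable_fin_num.
- by rewrite integrable_fin_num.
Qed.

Lemma normr_fine_expectation u :
  L1 P u -> (`|fine 'E_P[u]|%:E <= 'N[P]_1[EFin \o u]).
Proof.
move=> Lu; have iu := (L1_integrable P _).1 Lu.
have fin : 'E_P[u] \is a fin_num by exact: expectation_fin_num.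
have h := le_abse_integral P measurableT (measurable_int _ iu).
have E : 'E_P[u] = \int[P]_w (EFin \o u) w by rewrite unlock.
by rewrite Lnorm1 (le_trans _ h)// -E -[X in _ <= abse X](fineK fin).
Qed.

End truncation.

(** * Densities, and the dual of the closure of L^oo *)

Section dual_of_closure.
Context {d : measure_display} {T : measurableType d} {R : realType}.
Variables (P : probability T R) (rho : (T -> R) -> \bar R).
Hypothesis rhoP : risk_functional P rho.
Implicit Types (u v xi y : T -> R).
Let sL := subspace_Linf P.
Let s1 := subspace_L1 P.
Let sN := norm_rho_seminormed rhoP.
Let sLr := seminormed_subspace sN.

Lemma alpha_L1_le y (b a : R) : L1 P y -> (0 < b)%R ->
  alpha_L1 P rho (abs_div y b) <= a%:E <->
  forall xi, Linf_nneg P xi ->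
    'E_P[(xi \* abs_div y b)%R] <= (a + fine (rho xi))%:E.
Proof.
move=> Ly b0; split=> [h xi Lx|h].
  rewrite EFinD (fineK (rho_nneg_fin rhoP Lx)) -leeBlDr ?(rho_nneg_fin rhoP Lx)//.
  by apply: le_trans h; apply: ereal_sup_ubound; exists xi.
apply: ge_ereal_sup => _ [xi Lx <-].
rewrite leeBlDr ?(rho_nneg_fin rhoP Lx)//.
by rewrite -(fineK (rho_nneg_fin rhoP Lx)) -EFinD; exact: h.
Qed.

Lemma alpha_L1_fin y (b : R) : alpha_L1 P rho (abs_div y b) < +oo ->
  exists2 a : R, (0 <= a)%R & alpha_L1 P rho (abs_div y b) = a%:E.
Proof.
move=> h; have ge0 : 0 <= alpha_L1 P rho (abs_div y b).
  apply: ereal_sup_ubound; exists (fun=> 0%R).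
    by split; [exact: Linf_cst|exact: nearW].
  rewrite (risk_0 rhoP) sube0 unlock integral0_eq// => w _.
  by rewrite /= mul0r.
exists (fine (alpha_L1 P rho (abs_div y b))); first exact: fine_ge0.
by rewrite fineK// ge0_fin_numE.
Qed.

(** Counterpart of [rho_m_le_norm_rho] for a density. The left-hand side is now an integral and not
    a supremum over bounded functions, so unbounded [u] are reached by truncation. *)
Lemma norm1_mul_Lalpha y (b a : R) u : L1 P y -> (0 < b)%R -> (0 <= a)%R ->
  alpha_L1 P rho (abs_div y b) <= a%:E -> Lrho P rho u ->
  'N[P]_1[EFin \o (u \* y)%R] <= (b * (a + 1))%:E * norm_rho rho u.
Proof.
move=> Ly b0 a0 /(alpha_L1_le _ Ly b0) h Lu; have Lu1 := Lrho_L1 Lu.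
have mu := L1_measurable Lu1; have my := L1_measurable Ly.
rewrite (seminormedE sN Lu) -EFinM; set n := fine _.
have n0 : (0 <= n)%R by rewrite fine_ge0// norm_rho_ge0.
have q0 : (0 < b * (a + 1))%R by rewrite mulr_gt0// ltr_wpDl.
apply/lee_addgt0Pr => e e0; pose g := (n + e / (b * (a + 1)))%R.
have [g0 hg] : (0 < g)%R /\ rho (abs_div u g) <= 1.
  apply: (norm_rho_lt rhoP Lu1).
  by rewrite (seminormedE sN Lu) lte_fin ltrDl divr_gt0.
rewrite -EFinD (_ : b * (a + 1) * n + e = b * (a + 1) * g)%R; last first.
  by rewrite /g; field; rewrite !gt_eqF// ltr_wpDl.
rewrite Lnorm1 (_ : (fun w => _) = fun w => (`|u w| * `|y w|)%:E); last first.
  by apply/funext => w; rewrite -normrM.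
apply: integral_truncation_le => // k.
have Lt := Linf_truncation P k mu.
have Ldt := Linf_abs_div g Lt.
have nnt : Linf_nneg P (abs_div (truncation u k) g).
  by split => //; apply: nearW => w; rewrite abs_div_ge0// ltW.
have rt : (fine (rho (abs_div (truncation u k) g)) <= 1)%R.
  rewrite -lee_fin fineK ?(rho_nneg_fin rhoP nnt)// (le_trans _ hg)//.
  apply: (rho_abs_div_le rhoP) => //; first exact: Linf_L1.
  by apply: nearW => w; rewrite normr_truncation ge_min lexx.
have := h _ nnt; rewrite unlock => hE.
(* The factor [g * b] undoes the divisions in [|truncation u k| / g] and [|y| / b]. *)
rewrite (_ : \int[P]_w _ = (g * b)%:E *
  \int[P]_w ((abs_div (truncation u k) g \* abs_div y b)%R w)%:E); last first.
  rewrite -integralZl//.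
    apply: eq_integral => w _; rewrite -EFinM; congr EFin.
    by rewrite /= /abs_div; field; rewrite !gt_eqF.
  by apply/(L1_integrable P)/L1_mul_Linf => //; exact: L1_abs_div.
apply: (@le_trans _ _ ((g * b)%:E * (a + 1)%:E)).
  apply: lee_wpmul2l; first by rewrite lee_fin mulr_ge0// ltW.
  by rewrite (le_trans hE)// lee_fin lerD2l.
by rewrite -EFinM lee_fin le_eqVlt; apply/orP; left; apply/eqP; ring.
Qed.

Lemma Lalpha_mul_L1 y u : Lalpha P rho y -> Lrho P rho u -> L1 P (u \* y)%R.
Proof.
move=> [Ly [b b0 hb]] Lu; have [a a0 ha] := alpha_L1_fin hb.
have Lu1 := Lrho_L1 Lu.
apply/L1P; split.
  by apply: measurable_funM; [exact: L1_measurable Lu1|exact: L1_measurable Ly].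
have le : alpha_L1 P rho (abs_div y b) <= a%:E by rewrite ha.
apply: le_lt_trans (norm1_mul_Lalpha Ly b0 a0 le Lu) _.
by rewrite (seminormedE sN Lu) -EFinM ltry.
Qed.

Lemma Lalpha_bounded y : Lalpha P rho y -> exists2 K : R, (0 < K)%R &
  bounded_on (Lrho P rho) (norm_rho rho) K (fun u => fine 'E_P[(u \* y)%R]).
Proof.
move=> Ly; have [Ly1 [b b0 hb]] := Ly; have [a a0 ha] := alpha_L1_fin hb.
have le : alpha_L1 P rho (abs_div y b) <= a%:E by rewrite ha.
exists (b * (a + 1))%R; first by rewrite mulr_gt0// ltr_wpDl.
move=> u Lu; apply: le_trans (norm1_mul_Lalpha Ly1 b0 a0 le Lu).
exact/normr_fine_expectation/Lalpha_mul_L1.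
Qed.

Lemma Lrho_tilde_Lrho : Lrho_tilde P rho `<=` Lrho P rho.
Proof. by move=> u []. Qed.

Lemma Linf_Lrho_tilde : Linf P `<=` Lrho_tilde P rho.
Proof.
move=> u Lu; split; first exact: Linf_Lrho.
by move=> e e0; exists u => //; rewrite subrr (norm_rho0 rhoP) lte_fin.
Qed.

Lemma Lrho_tilde_seminormed : seminormed (Lrho_tilde P rho) (norm_rho rho).
Proof.
split.
- split; first by apply: Linf_Lrho_tilde; exact: subspace0 sL.
  move=> a u v [Lu hu] [Lv hv]; split; first exact: sLr.2.
  move=> e e0; pose q := (`|a| + 1)%R.
  have q0 : (0 < q)%R by rewrite ltr_wpDl.
  have e1 : (0 < e / 2 / q)%R by rewrite !divr_gt0.
  have e2 : (0 < e / 2)%R by rewrite !divr_gt0.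
  have [u' Lu' hu'] := hu _ e1; have [v' Lv' hv'] := hv _ e2.
  have Lru' := Linf_Lrho rhoP Lu'; have Lrv' := Linf_Lrho rhoP Lv'.
  exists (a *: u' + v')%R; first exact: sL.2.
  have -> : (a *: u + v - (a *: u' + v') = a *: (u - u') + (v - v'))%R.
    by rewrite scalerBr opprD addrACA.
  have Luu := subspaceB sLr Lu Lru'; have Lvv := subspaceB sLr Lv Lrv'.
  apply: le_lt_trans (seminormedD sN (subspaceZ sLr a Luu) Lvv) _.
  rewrite [e]splitr EFinD; apply: lteD => //.
  rewrite (seminormedZ sN a Luu); move: hu'; rewrite (seminormedE sN Luu) -EFinM !lte_fin.
  rewrite ltr_pdivlMr// => hu'; apply: le_lt_trans hu'.
  by rewrite mulrC ler_wpM2l// ?lerDl// fine_ge0// norm_rho_ge0.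
- by move=> u _; exact: norm_rho_ge0.
- by move=> u [[]].
- by move=> a u /Lrho_tilde_Lrho; exact: (seminormedZ sN).
- by move=> u v /Lrho_tilde_Lrho Lu /Lrho_tilde_Lrho; exact: (seminormedD sN).
Qed.

Lemma dense_Linf_Lrho_tilde : dense_in (Lrho_tilde P rho) (norm_rho rho) (Linf P).
Proof. by move=> u []. Qed.

Lemma Lalpha_dual y : Lalpha P rho y ->
  dual_space (Lrho_tilde P rho) (norm_rho rho) (fun u => fine 'E_P[(u \* y)%R]).
Proof.
move=> Ly; have [K K0 bK] := Lalpha_bounded Ly.
have l : linear_on (Lrho_tilde P rho) (fun u => fine 'E_P[(u \* y)%R]).
  by apply: expectation_linear => u /Lrho_tilde_Lrho; exact: Lalpha_mul_L1.
split=> //; apply: (bounded_continuous Lrho_tilde_seminormed (K := K) l).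
by move=> u /Lrho_tilde_Lrho; exact: bK.
Qed.

Lemma Lalpha_unique y y' : Lalpha P rho y -> Lalpha P rho y' ->
  (forall u, Linf P u -> fine 'E_P[(u \* y)%R] = fine 'E_P[(u \* y')%R]) ->
  \forall w \ae P, y' w = y w.
Proof.
move=> [Ly _] [Ly' _] yy'.
have iy := (L1_integrable P _).1 Ly; have iy' := (L1_integrable P _).1 Ly'.
have : ae_eq P setT (EFin \o y') (EFin \o y).
  apply: integral_ae_eq => //; first exact: measurable_int iy.
  move=> A _ mA; have LA := Linf_indic P mA.
  have := yy' _ LA; rewrite -!expectation_indicM// => h.
  rewrite -[LHS]fineK ?expectation_fin_num//; last exact: L1_mul_Linf.
  rewrite -[RHS]fineK ?expectation_fin_num//; last exact: L1_mul_Linf.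
  by rewrite h.
by apply: filterS => w /(_ I) [].
Qed.

Lemma charge_exists (mu : set T -> \bar R) :
  (forall A, measurable A -> mu A \is a fin_num) -> mu set0 = 0 ->
  semi_sigma_additive mu ->
  exists m : {charge set T -> \bar R}%R, forall A, m A = mu A.
Proof.
move=> fmu mu0 amu.
pose i := isCharge.Build d T R mu mu0 fmu amu.
pose m : {charge set T -> \bar R}%R := HB.pack mu i.
by exists m.
Qed.

Section vanishing.
Hypothesis vanish : vanishes_along_decreasing P (Linf P) rho.

(** The hypothesis concerns [rho] and not the norm. Applied to [\1_(B n) / e] for each fixed [e], it
    makes [rho] eventually at most 1, which is the norm bound [e]. *)
Lemma norm_rho_indic_cvg0 (B : nat -> set T) : (forall n, measurable (B n)) ->
  (forall n, B n.+1 `<=` B n) -> (forall w, \forall n \near \oo, ~ B n w) ->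
  forall e : R, (0 < e)%R ->
  exists n0, forall n, (n0 <= n)%N -> norm_rho rho (\1_(B n)) <= e%:E.
Proof.
move=> mB dB B0 e e0.
pose xi_ n : T -> R := abs_div \1_(B n) e.
have Lxi n : Linf P (xi_ n) by apply: Linf_abs_div; exact: Linf_indic.
have [n0 hn0] : exists n0, forall n, (n0 <= n)%N -> rho (xi_ n) <= 1.
  apply/cvge0_near_le1/vanish => //.
  - move=> n; apply: nearW => w; rewrite /xi_ /abs_div ler_wpM2r ?invr_ge0 ?(ltW e0)//.
    rewrite !indicE; have [/set_mem/dB/mem_set-> //|_] := boolP (w \in B n.+1).
    by rewrite normr0.
  - apply: nearW => w; apply: cvg_near_cst; apply: filterS (B0 w) => n nB.
    by rewrite /xi_ /abs_div indicE memNset// normr0 mul0r.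
exists n0 => n nn0; apply/(norm_rho_leP rhoP) => //; last exact: hn0.
exact/Linf_L1/Linf_indic.
Qed.

Lemma dual_Lrho_tilde_density phi :
  dual_space (Lrho_tilde P rho) (norm_rho rho) phi ->
  exists y, [/\ Lalpha P rho y,
    forall u, Lrho_tilde P rho u -> phi u = fine 'E_P[(u \* y)%R] &
    forall y', Lalpha P rho y' ->
      (forall u, Lrho_tilde P rho u -> phi u = fine 'E_P[(u \* y')%R]) ->
      \forall w \ae P, y' w = y w].
Proof.
move=> [lp cp]; have sT := Lrho_tilde_seminormed.
have [K K0 bp] := continuous_bounded sT lp cp.
have bpL : forall u, Linf P u -> `|phi u|%:E <= K%:E * norm_rho rho u.
  by move=> u /Linf_Lrho_tilde; exact: bp.
have lpL := linear_onS Linf_Lrho_tilde lp.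
have bpN := bounded_on_Linf rhoP (ltW K0) bpL.
have [m [Mm mE mI]] := charge_of_functional (ltW K0) lpL bpN.
have smu : semi_sigma_additive (fun A => (phi \1_A)%:E).
  move=> F mF tF mUF; pose U := \bigcup_n F n.
  pose V n := \big[setU/set0]_(i < n) F i.
  have mV n : measurable (V n) by exact: bigsetU_measurable.
  have VU n : V n `<=` U by rewrite /V -bigcup_mkord => w [i _ Fi]; exists i.
  (* The tails [B n] decrease to the empty set, so their norms tend to 0 and with them
     [phi \1_(B n)]: countable additivity as continuity at the empty set. *)
  pose B n := U `\` V n.
  have mB n : measurable (B n) by exact: measurableD.
  have sumE n : (\sum_(0 <= i < n) (phi \1_(F i))%:E) = (phi \1_(V n))%:E.
    rewrite big_mkord -mE (@charge_semi_additive _ _ _ m F n mF tF (mV n)).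
    by apply: eq_bigr => i _; rewrite mE.
  under eq_fun do rewrite sumE.
  have -> : (fun n => (phi \1_(V n))%:E) = (fun n => (phi \1_U - phi \1_(B n))%R%:E).
    apply/funext => n; congr EFin.
    rewrite -(linear_onB sL lpL); [|exact: Linf_indic|exact: Linf_indic].
    congr phi; apply/funext => w; rewrite !fctE !indicE.
    have [wV|/negP wV] := boolP (w \in V n).
      rewrite (mem_set (VU n w (set_mem wV))).
      have /negbTE-> : w \notin B n by apply/negP => /set_mem[_]; apply; exact: set_mem.
      by rewrite subr0.
    have [wU|/negP wU] := boolP (w \in U).
      have -> : w \in B n.
        by apply/mem_set; split; [exact: set_mem|move=> /mem_set].
      by rewrite subrr.
    have /negbTE-> : w \notin B n by apply/negP => /set_mem[/mem_set].
    by rewrite subrr.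
  apply: cvg_EFin; first exact: nearW.
  rewrite -[X in _ --> X]subr0; apply: cvgB; first exact: cvg_cst.
  apply/cvgrPdist_le => e e0.
  have eK : (0 < e / K)%R by exact: divr_gt0.
  have [||n0 hn0] := norm_rho_indic_cvg0 mB _ _ eK.
  - move=> n w [Uw nV]; split => // Vw; apply: nV.
    by move: Vw; rewrite /V -!bigcup_mkord => -[i /= ilt Fi]; exists i => //=; exact: leqW.
  - move=> w; have [[i _ Fi]|nU] := pselect (U w); last by apply: nearW => n [].
    exists i.+1 => // n /= ilt [_]; apply.
    by rewrite /V -bigcup_mkord; exists i.
  exists n0 => // n /= nn0; rewrite sub0r normrN.
  have LB := Linf_indic P (mB n).
  rewrite -lee_fin (le_trans (bpL _ LB))//.
  rewrite -[leRHS](_ : K%:E * (e / K)%:E = _); last first.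
    by rewrite -EFinM mulrC divfK// gt_eqF.
  by apply: lee_wpmul2l; [rewrite lee_fin ltW|exact: hn0].
have [//||nu nuE] := charge_exists _ _ smu.
  by rewrite indic0 (linear_on0 sL lpL).
have nuP : nu `<< P.
  apply/null_content_dominatesP => A mA PA; rewrite nuE -mE.
  by have [/null_content_dominatesP mP _] := Mm; exact: mP.
pose f := Radon_Nikodym nu P.
have ifP : P.-integrable setT f by exact: Radon_Nikodym_integrable.
have ff w : f w \is a fin_num by exact: Radon_Nikodym_fin_num.
pose y w := fine (f w).
have yf : EFin \o y = f by apply/funext => w; rewrite /= fineK.
have Ly : L1 P y by apply/L1_integrable; rewrite yf.
have my := L1_measurable Ly.
pose G u := fine 'E_P[(u \* y)%R].
have lG : linear_on (Linf P) G.
  by apply: expectation_linear => u Lu; exact: L1_mul_Linf.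
have nuG A : measurable A -> nu A = (G \1_A)%:E.
  move=> mA; rewrite /G fineK; last first.
    by apply: expectation_fin_num; apply: L1_mul_Linf => //; exact: Linf_indic.
  rewrite expectation_indicM// (Radon_Nikodym_integral nuP mA).
  by apply: eq_integral => w _; rewrite fineK.
pose C := fine 'N[P]_1[EFin \o y].
have yC : 'N[P]_1[EFin \o y] = C%:E by rewrite (seminormedE (L1_seminormed P) Ly).
have bG : bounded_on (Linf P) (fun u => 'N[P]_+oo[EFin \o u]) C G.
  move=> u Lu; have Luy := L1_mul_Linf Lu Ly.
  rewrite (le_trans (normr_fine_expectation Luy))//.
  rewrite (seminormedE (Linf_seminormed P) Lu); set k := fine _.
  have uk : \forall w \ae P, (`|u w| <= k)%R.
    by apply/Linf_norm_le; rewrite (seminormedE (Linf_seminormed P) Lu).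
  apply: (@le_trans _ _ 'N[P]_1[EFin \o (k *: y)%R]).
    apply: le_Lnorm1.
    - exact: L1_measurable Luy.
    - exact/L1_measurable/(subspaceZ s1 k Ly).
    apply: filterS uk => w uk; rewrite !fctE !normrM ler_wpM2r//.
    by rewrite (le_trans uk)// ler_norm.
  rewrite (seminormedZ (L1_seminormed P))// yC -!EFinM lee_fin mulrC.
  by rewrite ger0_norm// fine_ge0// Lnorm_ge0.
have phiG u : Linf P u -> phi u = G u.
  move=> Lu; rewrite -(int_Linf_continuous_indic lG bG nuG Lu).
  by rewrite (int_Linf_continuous_indic lpL bpN)// => A mA; rewrite nuE.
have Lay : Lalpha P rho y.
  split=> //; exists K => //; apply: (@le_lt_trans _ _ 1%:E); last exact: ltry.
  apply/(alpha_L1_le _ Ly K0) => xi Lx.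
  have rx : (0 <= fine (rho xi))%R.
    by apply: fine_ge0; apply: (rho_ge0 rhoP); [exact/Linf_L1/Lx.1|exact: Lx.2].
  pose B := y @^-1` `[0%R, +oo[.
  have mB : measurable B by rewrite -[X in measurable X]setTI; exact: my.
  (* The sign of [y], with value 1 where [y = 0]. Testing [phi] with [xi * sg] turns its bound into
     one on [E[xi |y|]], as [alpha_L1] at [|y| / K] requires. *)
  pose sg : T -> R := (2 *: \1_B - cst 1)%R.
  have sgy w : (sg w * y w = `|y w|)%R.
    rewrite /sg !fctE indicE; have [|wB] := boolP (w \in B).
      move=> /set_mem; rewrite /B /= in_itv/= andbT => y0.
      by rewrite ger0_norm// -[2 *: _]/(2 * _)%R; ring.
    rewrite ltr0_norm; last first.
      by rewrite ltNge; apply: contra wB => y0; apply: mem_set; rewrite /B /= in_itv/= y0.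
    by rewrite scaler0 sub0r mulN1r.
  have sg1 w : (`|sg w| <= 1)%R.
    rewrite /sg !fctE indicE -[2 *: _]/(2 * _)%R; case: (w \in B) => /=.
      by rewrite mulr1 (_ : 2 - 1 = 1)%R ?normr1//; ring.
    by rewrite mulr0 sub0r normrN1.
  have msg : measurable_fun setT sg.
    apply/(@L1_measurable _ _ _ P)/(subspaceB s1); last exact: L1_cst.
    exact/(subspaceZ s1)/Linf_L1/Linf_indic.
  pose v := (xi \* sg)%R.
  have mv : measurable_fun setT v by apply: measurable_funM => //; exact: Linf_measurable Lx.1.
  have vxi w : (`|v w| <= `|xi w|)%R by rewrite normrM ler_piMr.
  have Lv : Linf P v by apply: (Linf_ae_dominated mv Lx.1); exact: nearW.
  have Lvy := L1_mul_Linf Lv Ly.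
  have -> : 'E_P[(xi \* abs_div y K)%R] = (K^-1)%:E * 'E_P[(v \* y)%R].
    rewrite unlock -integralZl//; last exact/L1_integrable.
    apply: eq_integral => w _; rewrite -EFinM; congr EFin.
    by rewrite /= /v /abs_div -sgy /=; ring.
  have fvy : 'E_P[(v \* y)%R] \is a fin_num by exact: expectation_fin_num.
  rewrite -(fineK fvy) -/(G v) -phiG// -EFinM lee_fin ler_pdivrMl//.
  rewrite -lee_fin (le_trans (le_trans _ (bpL v Lv)))//; first by rewrite lee_fin ler_norm.
  rewrite EFinM; apply: lee_wpmul2l; first by rewrite lee_fin ltW.
  apply: (norm_rho_le_max rhoP); [exact: Linf_L1|by rewrite lerDl|].
  apply: (@le_trans _ _ (rho xi)).
    apply: (risk_nondecreasing rhoP); [exact/L1_norm/Linf_L1|exact/Linf_L1/Lx.1|].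
    by apply: filterS Lx.2 => w x0; rewrite (le_trans (vxi w))// ger0_norm.
  by rewrite -(fineK (rho_nneg_fin rhoP Lx)) lee_fin lerDr.
exists y; split => //.
  (* The representation is known on [L^oo]; both sides are continuous, and [L^oo] is dense in its
     closure. *)
  have [_ cG] := Lalpha_dual Lay.
  exact: (eq_on_dense sT Linf_Lrho_tilde dense_Linf_Lrho_tilde cp cG phiG).
move=> y' Lay' hy'; apply: (Lalpha_unique Lay Lay') => u Lu.
by rewrite -/(G u) -phiG// hy'//; exact: Linf_Lrho_tilde.
Qed.

End vanishing.

Lemma Lrho_tildeE : vanishes_along_decreasing P (dom P rho) rho ->
  Lrho_tilde P rho = [set u | L1 P u /\
    forall b : R, (0 < b)%R -> rho (abs_div u b) < +oo].
Proof.
move=> vanish; apply/seteqP; split=> u.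
  move=> [Lu hu]; have Lu1 := Lrho_L1 Lu; split=> // b b0.
  (* Half the scale leaves room for convexity: [|u| / b] is at most the midpoint of
     [|u - v| / (b / 2)], where [rho] is at most 1, and [|v| / (b / 2)], which is bounded. *)
  have b2 : (0 < b / 2)%R by rewrite divr_gt0.
  have [v Lv huv] := hu _ b2; have Lv1 := Linf_L1 Lv.
  have Luv1 := subspaceB s1 Lu1 Lv1.
  have [_ h1] := norm_rho_lt rhoP Luv1 huv.
  have [k k0 vk] := Linf_ae_bound Lv.
  have Ldv := L1_abs_div (b / 2) Lv1.
  have h2 : rho (abs_div v (b / 2)) <= (k / (b / 2))%:E.
    apply: (rho_le_cst rhoP) => //; apply: filterS vk => w vk.
    by rewrite ger0_norm ?(abs_div_ge0 _ _ (ltW b2))// /abs_div ler_pM2r// invr_gt0.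
  have tt : (0 < (2^-1 : R) < 1)%R by apply/andP; split; lra.
  have := risk_convex rhoP (L1_abs_div (b / 2) Luv1) Ldv h1 h2 tt.
  move=> h3; apply: le_lt_trans (le_lt_trans h3 (ltry _)).
  apply: (risk_nondecreasing rhoP).
  - exact: L1_abs_div.
  - by apply: s1.2; [exact: L1_abs_div|apply: (subspaceZ s1); exact: L1_abs_div].
  apply: nearW => w; rewrite !fctE /abs_div ?fctE -![_ *: _]/(_ * _)%R.
  have -> : (2^-1 * (`|u w - v w| / (b / 2)) + (1 - 2^-1) * (`|v w| / (b / 2)) =
     (`|u w - v w| + `|v w|) / b)%R by field; rewrite gt_eqF.
  rewrite ler_pM2r ?invr_gt0//.
  by rewrite -[X in (`|X| <= _)%R](subrK (v w)) ler_normD.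
move=> [Lu hu]; have mu := L1_measurable Lu.
have r0 b : (0 < b)%R -> 0 <= rho (abs_div u b).
  move=> b0; apply: (rho_ge0 rhoP); first exact: L1_abs_div.
  by apply: nearW => w; rewrite abs_div_ge0// ltW.
split.
  split=> //; have h := hu 1%R ltr01.
  have f1 : rho (abs_div u 1) \is a fin_num by rewrite ge0_fin_numE// r0.
  apply: le_lt_trans (ltry (Num.max 1 (fine (rho (abs_div u 1))))%R).
  apply: (norm_rho_le_max rhoP) => //; first by rewrite le_max lexx.
  by rewrite -abs_div1 -[leLHS](fineK f1) lee_fin le_max lexx orbT.
move=> e e0; have e2 : (0 < e / 2)%R by rewrite divr_gt0.
have Lt n := Linf_truncation P n mu.
have Ld n : L1 P (u - truncation u n)%R by apply: (subspaceB s1) => //; exact: Linf_L1.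
(* These functions decrease to 0 and stay in [dom rho], because they lie below [|u| / (e / 2)]. The
   radius [e / 2] yields the strict inequality in the definition of the closure. *)
pose xi_ n := abs_div (u - truncation u n)%R (e / 2).
have [n0 hn0] : exists n0, forall n, (n0 <= n)%N -> rho (xi_ n) <= 1.
  apply/cvge0_near_le1/vanish.
  - move=> n; split; first exact: L1_abs_div.
    apply: le_lt_trans (hu _ e2); apply: (rho_abs_div_le rhoP) => //.
    apply: nearW => w; rewrite !fctE normrB_truncation lerBlDr lerDl.
    by rewrite le_min normr_ge0 ler0n.
  - move=> n; apply: nearW => w; rewrite /xi_ /abs_div !fctE !normrB_truncation.
    rewrite ler_wpM2r ?invr_ge0 ?(ltW e2)// lerD2l lerN2.
    by rewrite le_min ge_min lexx/= ge_min ler_nat leqnSn orbT.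
  - apply: nearW => w; apply: cvg_near_cst; apply: filterS (near_min_natr `|u w|%R) => n h.
    by rewrite /xi_ /abs_div !fctE normrB_truncation h subrr mul0r.
exists (truncation u n0); first exact: Lt.
apply: (@le_lt_trans _ _ (e / 2)%:E); last by rewrite lte_fin ltr_pdivrMr// ltr_pMr// ltr1n.
by apply/(norm_rho_leP rhoP) => //; exact: hn0.
Qed.

Lemma Lrho_tilde_cone : vanishes_along_decreasing P (dom P rho) rho ->
  is_cone (dom P rho) -> Lrho P rho = Lrho_tilde P rho.
Proof.
move=> vanish cone; rewrite (Lrho_tildeE vanish); apply/seteqP; split=> u; last first.
  by rewrite -(Lrho_tildeE vanish) => -[].
move=> Lu; have Lu1 := Lrho_L1 Lu; split=> // b b0.
have nn : (0 <= fine (norm_rho rho u))%R by rewrite fine_ge0// norm_rho_ge0.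
have [g0 hg] : (0 < fine (norm_rho rho u) + 1)%R /\
    rho (abs_div u (fine (norm_rho rho u) + 1)) <= 1.
  apply: (norm_rho_lt rhoP) => //.
  by rewrite [ltLHS](seminormedE sN Lu) lte_fin ltrDl.
set g := (_ + 1)%R in g0 hg.
have du : dom P rho (abs_div u g).
  by split; [exact: L1_abs_div|exact: le_lt_trans hg (ltry 1)].
(* [|u| / g] lies in [dom rho] because [g] exceeds the norm; the cone property rescales it to
   [|u| / b]. *)
have [_] := cone (g / b)%R _ (divr_gt0 g0 b0) du.
rewrite (_ : (g / b) *: abs_div u g = abs_div u b)%R//.
apply/funext => w; rewrite fctE /abs_div -[_ *: _]/(_ * _)%R.
by field; rewrite !gt_eqF.
Qed.

End dual_of_closure.

Unset Implicit Arguments.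

Theorem mainTheorem5 (R : realType) (d : measure_display)
  (T : measurableType d) (P : probability T R) (rho : (T -> R) -> \bar R)
  (rho_convex : convex_L1 P rho)
  (rho_nondecreasing : nondecreasing_L1 P rho)
  (rho_0 : rho (fun=> 0%R) = 0)
  (rho_translation : forall (xi : T -> R) (a : R), L1 P xi ->
     rho (fun w => xi w + a)%R = rho xi + a%:E)
  (rho_lsc : lsc_L1 P rho)
  (c : R) (c_gt0 : (0 < c)%R)
  (rho_L1 : forall u : T -> R, L1 P u ->
     rho (fun w => `|u w|%R) <= 1 -> 'N[P]_1[EFin \o u] <= c%:E) :
  (* L^rho is a Banach space *)
  banach_mod_ae P (Lrho P rho) (norm_rho rho) /\
  (* the dual of L^rho *)
  ((forall m u, Mrho P rho m -> Lrho P rho u -> dom P (rho_m P m) u) /\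
   (forall m z, Mrho P rho m -> annihilator_Linf P rho z ->
      dual_space (Lrho P rho) (norm_rho rho) (fun u => int_dom P m u + z u)%R) /\
   (forall phi, dual_space (Lrho P rho) (norm_rho rho) phi ->
      exists m z,
        [/\ Mrho P rho m, annihilator_Linf P rho z,
            forall u, Lrho P rho u -> phi u = (int_dom P m u + z u)%R &
            forall m' z', Mrho P rho m' -> annihilator_Linf P rho z' ->
              (forall u, Lrho P rho u -> phi u = (int_dom P m' u + z' u)%R) ->
              (forall A, measurable A -> m' A = m A) /\
              (forall u, Lrho P rho u -> z' u = z u)])) /\
  (* the dual norm on M *)
  (forall m, Mrho P rho m ->
     [/\ dual_norm_rho P rho m =
           ereal_sup [set (int_Linf P m u)%:E |
             u in [set u | Linf P u /\ rho (fun w => `|u w|%R) <= 1]],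
         dual_norm_rho P rho m =
           ereal_inf [set b%:E * alpha P rho (variation_div m b) + b%:E |
             b in [set b : R | (0 < b)%R]],
         norm_alpha P rho m <= dual_norm_rho P rho m &
         dual_norm_rho P rho m <= 2%:E * norm_alpha P rho m]) /\
  (* the dual of the closure of L^oo *)
  (vanishes_along_decreasing P (Linf P) rho ->
     (forall y, Lalpha P rho y ->
        (forall u, Lrho_tilde P rho u -> L1 P (u \* y)%R) /\
        dual_space (Lrho_tilde P rho) (norm_rho rho) (fun u => fine 'E_P[u \* y])) /\
     (forall phi, dual_space (Lrho_tilde P rho) (norm_rho rho) phi ->
        exists y,
          [/\ Lalpha P rho y,
              forall u, Lrho_tilde P rho u -> phi u = fine 'E_P[u \* y] &
              forall y', Lalpha P rho y' ->
                (forall u, Lrho_tilde P rho u -> phi u = fine 'E_P[u \* y']) ->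
                \forall w \ae P, y' w = y w])) /\
  (* characterization of the closure of L^oo *)
  (vanishes_along_decreasing P (dom P rho) rho ->
     Lrho_tilde P rho =
       [set u | L1 P u /\
          forall b : R, (0 < b)%R -> rho (abs_div u b) < +oo] /\
     (is_cone (dom P rho) -> Lrho P rho = Lrho_tilde P rho)).
Proof.
have rhoP : risk_functional P rho by split.
split; first exact: (banach_Lrho rhoP c_gt0 rho_L1 (complete_L1 (P := P))).
split.
  split; last split.
  - by move=> m u [Mm am] Lu; exact: (Lrho_dom_rho_m rhoP Mm am Lu).
  - by move=> m z; exact: dual_Lrho_sum.
  - by move=> phi; exact: dual_Lrho_decomposition.
split.
  move=> m [Mm am]; split.
  - exact: dual_norm_rhoE.
  - exact: dual_norm_rho_inf.
  - exact: norm_alpha_le.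
  - exact: dual_norm_le_norm_alpha.
split.
  move=> vanish; split.
    move=> y Ly; split; last exact: Lalpha_dual.
    by move=> u [Lu _]; exact: (Lalpha_mul_L1 rhoP Ly Lu).
  by move=> phi; exact: dual_Lrho_tilde_density.
by move=> vanish; split; [exact: Lrho_tildeE|exact: Lrho_tilde_cone].
Qed.
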